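(* The system $\mathrm{RCA}_0^\omega+\mathrm{QF\text{-}AC}^{0,1}$ proves that $\mathbb{R}$ is a sequential space, i.e. that a subset of $\mathbb{R}$ is sequentially closed if and only if it is closed.
   Context: Base theory. Finite types: $0$ (natural numbers) is a type, and if $\sigma,\tau$ are types then so is $\sigma\to\tau$ (mappings from type $\sigma$ to type $\tau$ objects); $1:=0\to0$ and $n+1:=n\to0$; a superscript on a variable is its type. $L_\omega$ is the language with variables and quantifiers of all finite types, constants $0,1,<_0,+_0,\times_0,=_0$ on $\mathbb{N}$, the combinators $\Pi,\Sigma$ and a recursor constant $\mathbf{R}_0$. Equality at higher types is defined extensionally: $x=_\tau y$ iff $xz_1\dots z_k=_0yz_1\dots z_k$ for all arguments. $\mathrm{QF\text{-}AC}^{\sigma,\tau}$ is the schema $(\forall x^\sigma)(\exists y^\tau)A(x,y)\to(\exists Y^{\sigma\to\tau})(\forall x^\sigma)A(x,Y(x))$ for quantifier-free $A$ of $L_\omega$ (parameters of any type allowed); $\mathrm{QF\text{-}AC}^{0,1}$ is the case $\sigma=0,\tau=1$. $\mathrm{RCA}_0^\omega$ is the theory in $L_\omega$ with classical logic and the axioms: $\mathbb{N}$ is an ordered semi-ring; the defining axioms of $\Pi,\Sigma$ (giving $\lambda$-abstraction); $\mathbf{R}_0(f,m,0)=m$ and $\mathbf{R}_0(f,m,n+1)=f(n,\mathbf{R}_0(f,m,n))$; extensionality $x=_\rho y\to\varphi(x)=_\tau\varphi(y)$ for all types $\rho,\tau$ and $\varphi^{\rho\to\tau}$; induction for quantifier-free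 formulas of $L_\omega$; $\mathrm{QF\text{-}AC}^{1,0}$. Reals. A real is a sequence of rationals $(q_n)$ with $|q_n-q_{n+i}|<2^{-n}$ for all $n,i$ (a type 1 object); $(q_n)=_{\mathbb{R}}(r_n)$ iff $|q_n-r_n|\le2^{-n+1}$ for all $n$. A function $\mathbb{R}\to\mathbb{R}$ is a type $1\to1$ functional mapping equal reals to equal reals. Open and closed sets. Subsets of $\mathbb{R}$ are represented by functions $Y:\mathbb{R}\to\mathbb{R}$, where $x\in Y$ stands for $|Y(x)|>_{\mathbb{R}}0$. The complement $Y^c$ is given by $x\in Y^c\leftrightarrow\neg(x\in Y)$. A set is open if for each of its points $x$ there is a rational $r>0$ (coded as a type 0 object) such that the open ball $B(x,r)$ is contained in the set. A set $F$ is closed if its complement $F^c$ is open. A set $F$ is sequentially closed if for any sequence $(x_n)$ and $x$ in $\mathbb{R}$: $[(\forall n\in\mathbb{N})(x_n\in F)\wedge\lim_{n\to\infty}x_n=x]\to x\in F$. A space is sequential if ''sequentially closed'' and ''closed'' coincide for its subsets. *)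

(* Defs.v *)
From Stdlib Require Import List.
Import ListNotations.
Set Implicit Arguments.
Unset Strict Implicit.
Unset Printing Implicit Defensive.

Declare Scope ty_scope.
Declare Scope tm_scope.
Declare Scope fm_scope.
Delimit Scope ty_scope with ty.
Delimit Scope tm_scope with tm.
Delimit Scope fm_scope with fm.

(** * The language L_omega

    Intrinsically typed de Bruijn syntax: [tm G s] and [fm G] are the terms of
    type [s] and the formulas whose free variables are declared in [G]. *)

Inductive ty : Type :=
| N : ty
| Arr : ty -> ty -> ty.
Bind Scope ty_scope with ty.
Notation "s ⇒ t" := (Arr s t) (at level 55, right associativity) : ty_scope.

Definition N1 : ty := (N ⇒ N)%ty.

Definition ctx : Type := list ty.

Inductive var : ctx -> ty -> Type :=
| vz : forall (G : ctx) (s : ty), var (s :: G) s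
| vs : forall (G : ctx) (s t : ty), var G s -> var (t :: G) s.
Arguments vz {G s}.
Arguments vs {G s t} _.

Definition vcase (G : ctx) (t : ty) (P : ty -> Type) (a : P t)
    (f : forall s, var G s -> P s) : forall s, var (t :: G) s -> P s :=
  fun s x =>
    match x in var G' s'
      return match G' with
             | [] => unit
             | t' :: G'' => P t' -> (forall s, var G'' s -> P s) -> P s'
             end
    with
    | vz => fun a _ => a
    | vs y => fun _ f => f _ y
    end a f.

(** [cPi], [cSig] are the combinators Π, Σ and [cRec] is the recursor R_0.
    The symbols =_0 and <_0 are the two relation symbols of [fm]. *)
Inductive tm (G : ctx) : ty -> Type :=
| tvar : forall s, var G s -> tm G s
| app : forall s t, tm G (s ⇒ t) -> tm G s -> tm G t
| cZero : tm G N
| cOne : tm G N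
| cAdd : tm G (N ⇒ N ⇒ N)
| cMul : tm G (N ⇒ N ⇒ N)
| cPi : forall s t, tm G (s ⇒ t ⇒ s)
| cSig : forall r s t, tm G ((r ⇒ s ⇒ t) ⇒ (r ⇒ s) ⇒ r ⇒ t)
| cRec : tm G ((N ⇒ N ⇒ N) ⇒ N ⇒ N ⇒ N).
Bind Scope tm_scope with tm.
Arguments cZero {G}.
Arguments cOne {G}.
Arguments cAdd {G}.
Arguments cMul {G}.
Arguments cPi {G s t}.
Arguments cSig {G r s t}.
Arguments cRec {G}.

Notation "f · x" := (app f x) (at level 32, left associativity) : tm_scope.
Notation "0" := cZero : tm_scope.
Notation "1" := cOne : tm_scope.
Notation "t + u" := (app (app cAdd t) u) : tm_scope.
Notation "t * u" := (app (app cMul t) u) : tm_scope.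
Local Open Scope tm_scope.

Inductive fm (G : ctx) : Type :=
| Eq0 : tm G N -> tm G N -> fm G
| Lt0 : tm G N -> tm G N -> fm G
| Bot : fm G
| Imp : fm G -> fm G -> fm G
| And : fm G -> fm G -> fm G
| Or : fm G -> fm G -> fm G
| All : forall s, fm (s :: G) -> fm G
| Ex : forall s, fm (s :: G) -> fm G.
Bind Scope fm_scope with fm.
Arguments Bot {G}.
Arguments All {G} s _.
Arguments Ex {G} s _.

Notation "t '=0' u" := (Eq0 t u) (at level 70) : fm_scope.
Notation "t '<0' u" := (Lt0 t u) (at level 70) : fm_scope.
Notation "A ==> B" := (Imp A B) (at level 90, right associativity) : fm_scope.
Notation "A /\ B" := (And A B) : fm_scope.
Notation "A \/ B" := (Or A B) : fm_scope.
Notation "~ A" := (Imp A Bot) : fm_scope.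
Notation "A <-> B" := (And (Imp A B) (Imp B A)) : fm_scope.
Local Open Scope fm_scope.

Definition Le0 (G : ctx) (t u : tm G N) : fm G := t <0 u \/ t =0 u.
Notation "t '<=0' u" := (Le0 t u) (at level 70) : fm_scope.

Fixpoint qfree (G : ctx) (A : fm G) : Prop :=
  match A with
  | Eq0 _ _ | Lt0 _ _ | Bot => True
  | Imp A B | And A B | Or A B => (qfree A /\ qfree B)%type
  | All _ _ | Ex _ _ => False
  end.

(** ** Renaming and substitution *)

Definition ren (G D : ctx) : Type := forall s, var G s -> var D s.
Definition sbs (G D : ctx) : Type := forall s, var G s -> tm D s.

Definition upr (G D : ctx) (t : ty) (r : ren G D) : ren (t :: G) (t :: D) :=
  vcase vz (fun s x => vs (r s x)).

Fixpoint tren (G D : ctx) (r : ren G D) (s : ty) (a : tm G s) : tm D s :=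
  match a with
  | tvar x => tvar (r _ x)
  | app f a => app (tren r f) (tren r a)
  | cZero => cZero
  | cOne => cOne
  | cAdd => cAdd
  | cMul => cMul
  | cPi => cPi
  | cSig => cSig
  | cRec => cRec
  end.

Definition twk (G : ctx) (s t : ty) (a : tm G s) : tm (t :: G) s :=
  tren (fun _ x => vs x) a.
Arguments twk {G s t} a.
Notation "↑ a" := (twk a) (at level 30, right associativity) : tm_scope.

Definition ups (G D : ctx) (t : ty) (r : sbs G D) : sbs (t :: G) (t :: D) :=
  vcase (tvar vz) (fun s x => ↑ r s x).

Fixpoint tsub (G D : ctx) (r : sbs G D) (s : ty) (a : tm G s) : tm D s :=
  match a with
  | tvar x => r _ x
  | app f a => app (tsub r f) (tsub r a)
  | cZero => cZero
  | cOne => cOne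
  | cAdd => cAdd
  | cMul => cMul
  | cPi => cPi
  | cSig => cSig
  | cRec => cRec
  end.

Fixpoint fren (G D : ctx) (r : ren G D) (A : fm G) : fm D :=
  match A with
  | Eq0 t u => Eq0 (tren r t) (tren r u)
  | Lt0 t u => Lt0 (tren r t) (tren r u)
  | Bot => Bot
  | Imp A B => Imp (fren r A) (fren r B)
  | And A B => And (fren r A) (fren r B)
  | Or A B => Or (fren r A) (fren r B)
  | All s A => All s (fren (upr r) A)
  | Ex s A => Ex s (fren (upr r) A)
  end.

Fixpoint fsub (G D : ctx) (r : sbs G D) (A : fm G) : fm D :=
  match A with
  | Eq0 t u => Eq0 (tsub r t) (tsub r u)
  | Lt0 t u => Lt0 (tsub r t) (tsub r u)
  | Bot => Bot
  | Imp A B => Imp (fsub r A) (fsub r B)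
  | And A B => And (fsub r A) (fsub r B)
  | Or A B => Or (fsub r A) (fsub r B)
  | All s A => All s (fsub (ups r) A)
  | Ex s A => Ex s (fsub (ups r) A)
  end.

Definition fwk (G : ctx) (t : ty) (A : fm G) : fm (t :: G) :=
  fren (fun _ x => vs x) A.

(** [inst A a] is A(a), where the variable of A being replaced is the
    innermost one; [fwk1] adds a variable to the context just below it. *)
Definition inst (G : ctx) (s : ty) (A : fm (s :: G)) (a : tm G s) : fm G :=
  fsub (vcase a (fun _ x => tvar x)) A.

Definition fwk1 (G : ctx) (s t : ty) (A : fm (s :: G)) : fm (s :: t :: G) :=
  fren (upr (fun _ x => vs x)) A.

Definition v0 {G : ctx} {s : ty} : tm (s :: G) s := tvar vz.
Definition v1 {G : ctx} {s s1 : ty} : tm (s1 :: s :: G) s := ↑ v0.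
Definition v2 {G : ctx} {s s1 s2 : ty} : tm (s2 :: s1 :: s :: G) s := ↑ v1.
Definition v3 {G : ctx} {s s1 s2 s3 : ty} : tm (s3 :: s2 :: s1 :: s :: G) s :=
  ↑ v2.

(** λ-abstraction, by the usual bracket abstraction. *)
Fixpoint lam (G : ctx) (s t : ty) (a : tm (s :: G) t) : tm G (s ⇒ t) :=
  match a with
  | tvar x =>
      vcase (P := fun t => tm G (s ⇒ t)) (cSig · cPi · (cPi : tm G (s ⇒ s ⇒ s)))
        (fun _ y => cPi · tvar y) x
  | app f b => cSig · lam f · lam b
  | cZero => cPi · cZero
  | cOne => cPi · cOne
  | cAdd => cPi · cAdd
  | cMul => cPi · cMul
  | cPi => cPi · cPi
  | cSig => cPi · cSig
  | cRec => cPi · cRec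
  end.

Fixpoint eqT (s : ty) : forall G : ctx, tm G s -> tm G s -> fm G :=
  match s with
  | N => fun _ x y => x =0 y
  | Arr s t => fun _ x y => All s (eqT (↑ x · v0) (↑ y · v0))
  end.

(** * Provability: classical natural deduction with equality at type 0

    An axiom may have free variables; by [AllI] it then stands for its
    universal closure. *)

Definition theory : Type := forall G : ctx, fm G -> Prop.

Inductive prf (T : theory) : forall G : ctx, list (fm G) -> fm G -> Prop :=
| Ax : forall G (H : list (fm G)) A, T G A -> prf T H A
| Hyp : forall G (H : list (fm G)) A, In A H -> prf T H A
| ImpI : forall G (H : list (fm G)) A B, prf T (A :: H) B -> prf T H (A ==> B)
| ImpE : forall G (H : list (fm G)) A B,
    prf T H (A ==> B) -> prf T H A -> prf T H B
| AndI : forall G (H : list (fm G)) A B,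
    prf T H A -> prf T H B -> prf T H (A /\ B)
| AndE1 : forall G (H : list (fm G)) A B, prf T H (A /\ B) -> prf T H A
| AndE2 : forall G (H : list (fm G)) A B, prf T H (A /\ B) -> prf T H B
| OrI1 : forall G (H : list (fm G)) A B, prf T H A -> prf T H (A \/ B)
| OrI2 : forall G (H : list (fm G)) A B, prf T H B -> prf T H (A \/ B)
| OrE : forall G (H : list (fm G)) A B C,
    prf T H (A \/ B) -> prf T (A :: H) C -> prf T (B :: H) C -> prf T H C
| AllI : forall G (H : list (fm G)) s (A : fm (s :: G)),
    prf T (map (fwk s) H) A -> prf T H (All s A)
| AllE : forall G (H : list (fm G)) s (A : fm (s :: G)) (a : tm G s),
    prf T H (All s A) -> prf T H (inst A a)
| ExI : forall G (H : list (fm G)) s (A : fm (s :: G)) (a : tm G s),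
    prf T H (inst A a) -> prf T H (Ex s A)
| ExE : forall G (H : list (fm G)) s (A : fm (s :: G)) C,
    prf T H (Ex s A) -> prf T (A :: map (fwk s) H) (fwk s C) -> prf T H C
| RAA : forall G (H : list (fm G)) A, prf T ((~ A) :: H) Bot -> prf T H A
| EqRefl : forall G (H : list (fm G)) (t : tm G N), prf T H (t =0 t)
| EqSubst : forall G (H : list (fm G)) (A : fm (N :: G)) (t u : tm G N),
    prf T H (t =0 u) -> prf T H (inst A t) -> prf T H (inst A u).

Definition proves (T : theory) (A : fm []) : Prop := prf T [] A.

(** * The systems *)

(** From (∀x)(∃y)A(x,y) to (∃Y)(∀x)A(x,Y(x)); in [A], y is the innermost
    variable and x the next one. *)
Inductive QFAC (s t : ty) : theory :=
| QFAC_ax : forall G (A : fm (t :: s :: G)), qfree A ->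
    QFAC s t (All s (Ex t A) ==>
      Ex (s ⇒ t) (All s
        (fsub (vcase (v1 · v0) (vcase v0 (fun _ x => tvar (vs (vs x))))) A))).

(** The first group states that (0,1,+,×,<) is a commutative semi-ring with a
    compatible strict linear order.  Discreteness and the non-negativity of all
    elements follow by quantifier-free induction. *)
Inductive RCA0w : theory :=
| addA : forall G (x y z : tm G N), RCA0w ((x + y) + z =0 x + (y + z))
| addC : forall G (x y : tm G N), RCA0w (x + y =0 y + x)
| add0 : forall G (x : tm G N), RCA0w (x + 0 =0 x)
| mulA : forall G (x y z : tm G N), RCA0w ((x * y) * z =0 x * (y * z))
| mulC : forall G (x y : tm G N), RCA0w (x * y =0 y * x)
| mul1 : forall G (x : tm G N), RCA0w (x * 1 =0 x)
| mul0 : forall G (x : tm G N), RCA0w (x * 0 =0 0)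
| mulDr : forall G (x y z : tm G N), RCA0w (x * (y + z) =0 x * y + x * z)
| lt01 : forall G : ctx, RCA0w (G := G) (0 <0 1)
| ltirr : forall G (x : tm G N), RCA0w (~ (x <0 x))
| lttrans : forall G (x y z : tm G N), RCA0w (x <0 y ==> y <0 z ==> x <0 z)
| lttotal : forall G (x y : tm G N), RCA0w (x <0 y \/ (x =0 y \/ y <0 x))
| ltadd : forall G (x y z : tm G N), RCA0w (x <0 y ==> x + z <0 y + z)
| ltmul : forall G (x y z : tm G N),
    RCA0w (0 <0 z ==> x <0 y ==> x * z <0 y * z)
| PiE : forall G s t (x : tm G s) (y : tm G t), RCA0w (eqT (cPi · x · y) x)
| SigE : forall G r s t (x : tm G (r ⇒ s ⇒ t)) (y : tm G (r ⇒ s)) (z : tm G r),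
    RCA0w (eqT (cSig · x · y · z) (x · z · (y · z)))
| RecO : forall G (f : tm G (N ⇒ N ⇒ N)) (m : tm G N),
    RCA0w (cRec · f · m · 0 =0 m)
| RecS : forall G (f : tm G (N ⇒ N ⇒ N)) (m n : tm G N),
    RCA0w (cRec · f · m · (n + 1) =0 f · n · (cRec · f · m · n))
| Extensionality : forall G r t (x y : tm G r) (f : tm G (r ⇒ t)),
    RCA0w (eqT x y ==> eqT (f · x) (f · y))
| QFInd : forall G (A : fm (N :: G)), qfree A ->
    RCA0w (inst A 0 ==> All N (A ==> inst (fwk1 N A) (v0 + 1)) ==> All N A)
| QFAC10 : forall G (A : fm G), QFAC N1 N A -> RCA0w A.

Definition RCA0w_QFAC01 : theory :=
  fun G A => (RCA0w A \/ QFAC N N1 A)%type.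

(** * Arithmetic and rationals *)

Definition tpred (G : ctx) (t : tm G N) : tm G N :=
  cRec · lam (lam v1) · 0 · t.

(** Truncated subtraction. *)
Definition tminus (G : ctx) (t u : tm G N) : tm G N :=
  cRec · lam (lam (tpred v0)) · t · u.
Notation "t ∸ u" := (tminus t u) (at level 50, left associativity) : tm_scope.

(** [tcond t a b] is [a] if t = 0 and [b] otherwise. *)
Definition tcond (G : ctx) (t a b : tm G N) : tm G N :=
  cRec · lam (lam (↑ ↑ b)) · a · t.

(** Integer part of the square root. *)
Definition tsqrt (G : ctx) (t : tm G N) : tm G N :=
  cRec · lam (lam (tcond ((v0 + 1) * (v0 + 1) ∸ (v1 + 1)) (v0 + 1) v0)) · 0 · t.

Definition tpow2 (G : ctx) (t : tm G N) : tm G N :=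
  cRec · lam (lam (v0 + v0)) · 1 · t.

(** The integer part of the square root of (i + j)^2 + i is i + j. *)
Definition tpair (G : ctx) (i j : tm G N) : tm G N := (i + j) * (i + j) + i.
Definition tfst (G : ctx) (p : tm G N) : tm G N := p ∸ tsqrt p * tsqrt p.
Definition tsnd (G : ctx) (p : tm G N) : tm G N := tsqrt p ∸ tfst p.

(** [qrat a b c] codes (a - b) / (c + 1).  Every number q is taken as the code
    of the rational (qpos q - qneg q) / qden q, so that a sequence of rationals
    is just an object of type 1. *)
Definition qrat (G : ctx) (a b c : tm G N) : tm G N := tpair (tpair a b) c.
Definition qpos (G : ctx) (q : tm G N) : tm G N := tfst (tfst q).
Definition qneg (G : ctx) (q : tm G N) : tm G N := tsnd (tfst q).
Definition qden (G : ctx) (q : tm G N) : tm G N := tsnd q + 1.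

Definition q0 (G : ctx) : tm G N := qrat 0 0 0.
Arguments q0 {G}.

(** 2^-n and 2^(-n+1). *)
Definition qhalf (G : ctx) (n : tm G N) : tm G N :=
  qrat 1 0 (tpred (tpow2 n)).
Definition qhalf1 (G : ctx) (n : tm G N) : tm G N :=
  qrat (1 + 1) 0 (tpred (tpow2 n)).

Definition qsub (G : ctx) (q r : tm G N) : tm G N :=
  qrat (qpos q * qden r + qneg r * qden q)
       (qneg q * qden r + qpos r * qden q)
       (tpred (qden q * qden r)).

Definition qabs (G : ctx) (q : tm G N) : tm G N :=
  qrat ((qpos q ∸ qneg q) + (qneg q ∸ qpos q)) 0 (tsnd q).

Definition qlt (G : ctx) (q r : tm G N) : fm G :=
  qpos q * qden r + qneg r * qden q <0 qpos r * qden q + qneg q * qden r.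
Definition qle (G : ctx) (q r : tm G N) : fm G :=
  qpos q * qden r + qneg r * qden q <=0 qpos r * qden q + qneg q * qden r.

(** * Reals *)

Definition is_real (G : ctx) (x : tm G N1) : fm G :=
  All N (All N (qlt (qabs (qsub (↑ ↑ x · v1) (↑ ↑ x · (v1 + v0)))) (qhalf v1))).

Definition req (G : ctx) (x y : tm G N1) : fm G :=
  All N (qle (qabs (qsub (↑ x · v0) (↑ y · v0))) (qhalf1 v0)).

(** The order goes with [req]: x <_R y iff y_n - x_n > 2^(-n+1) for some n. *)
Definition rlt (G : ctx) (x y : tm G N1) : fm G :=
  Ex N (qlt (qhalf1 v0) (qsub (↑ y · v0) (↑ x · v0))).

Definition rofq (G : ctx) (q : tm G N) : tm G N1 := lam (↑ q).

Definition rabs (G : ctx) (x : tm G N1) : tm G N1 := lam (qabs (↑ x · v0)).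

(** The shift by one makes the difference of two reals a real. *)
Definition rsub (G : ctx) (x y : tm G N1) : tm G N1 :=
  lam (qsub (↑ x · (v0 + 1)) (↑ y · (v0 + 1))).

Definition is_rfun (G : ctx) (Y : tm G (N1 ⇒ N1)) : fm G :=
  All N1 (is_real v0 ==> is_real (↑ Y · v0)) /\
  All N1 (All N1 (is_real v1 ==> is_real v0 ==>
    req v1 v0 ==> req (↑ ↑ Y · v1) (↑ ↑ Y · v0))).

(** * Subsets of the reals

    A set definable in the context [G] is a formula in [N1 :: G]; its
    membership formula is only used at reals. *)

Definition rset (G : ctx) : Type := fm (N1 :: G).

Definition mem (G : ctx) (x : tm G N1) (F : rset G) : fm G := inst F x.

Definition swk (G : ctx) (t : ty) (F : rset G) : rset (t :: G) := fwk1 t F.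

Definition compl (G : ctx) (F : rset G) : rset G := ~ F.

(** The set represented by Y: x ∈ Y stands for |Y(x)| >_R 0. *)
Definition set_of (G : ctx) (Y : tm G (N1 ⇒ N1)) : rset G :=
  rlt (rofq q0) (rabs (↑ Y · v0)).

(** y ∈ B(x,r), for a rational r. *)
Definition in_ball (G : ctx) (y x : tm G N1) (r : tm G N) : fm G :=
  rlt (rabs (rsub x y)) (rofq r).

Definition is_open (G : ctx) (F : rset G) : fm G :=
  All N1 (is_real v0 ==> mem v0 (swk N1 F) ==>
    Ex N (qlt q0 v0 /\
      All N1 (is_real v0 ==> in_ball v0 v2 v1 ==>
        mem v0 (swk N1 (swk N (swk N1 F)))))).

Definition is_closed (G : ctx) (F : rset G) : fm G := is_open (compl F).

Definition lim (G : ctx) (x : tm G (N ⇒ N1)) (l : tm G N1) : fm G :=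
  All N (Ex N (All N (v1 <=0 v0 ==>
    rlt (rabs (rsub (↑ ↑ ↑ x · v0) (↑ ↑ ↑ l))) (rofq (qhalf v2))))).

Definition is_seq_closed (G : ctx) (F : rset G) : fm G :=
  All (N ⇒ N1) (All N1 (
    All N (is_real (v2 · v0)) ==> is_real v0 ==>
    All N (mem (v2 · v0) (swk N (swk N1 (swk (N ⇒ N1) F)))) /\ lim v1 v0 ==>
    mem v0 (swk N1 (swk (N ⇒ N1) F)))).

Definition R_is_sequential : fm [] :=
  All (N1 ⇒ N1) (is_rfun v0 ==>
    (is_seq_closed (set_of v0) <-> is_closed (set_of v0))).

(* Main.v *)
From Pilot Require Import -(notations) Defs.
From HB Require Import structures.
From mathcomp Require Import all_boot all_order all_algebra ring lra boolp.
From Stdlib Require List Eqdep_dec.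

(** By completeness it suffices to argue in an arbitrary model whose equality at
    every type is extensional; its numbers are the nonnegative integers of an
    ordered field, in which coded rationals take their values.

    If x is a limit of points of a closed set F, a ball around x disjoint from F
    is impossible.  Conversely let F be sequentially closed and suppose that no
    ball around some x outside F avoids F.  That a point of F lies within 2^-k
    of x has a quantifier-free witness once sequences are forced to converge
    fast, so QF-AC^{0,1} yields a sequence of points of F converging to x, a
    contradiction. *)

Set Implicit Arguments.
Unset Strict Implicit.
Unset Printing Implicit Defensive.

Delimit Scope tm_scope with tm.
Notation "f · x" := (app f x) (at level 32, left associativity) : tm_scope.
Notation "t + u" := (app (app cAdd t) u) : tm_scope.

(** Formal derivations would be unwieldy, so the analysis is done inside a model. The price is that
    its numbers may be nonstandard: induction on them is available only for quantifier-free
    conditions, hence the bookkeeping with [dfn] and [qfp], while inequalities are moved to the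
    ordered field [K], where [lra] and [nra] apply. The obstacle in the choice step is the form of
    the condition on a point y: being real is a universal statement over numbers, membership in F
    and in a ball are existential ones. The universal one disappears because [tforce] turns every
    object of type 1 into a real; the two existential witnesses are stored in the first entry of the
    chosen sequence. A real need not pass the tests of [tforce], as its entries n and n+1 are only
    known to differ by less than 2^-n instead of 2^-(n+1). Dropping its first entry repairs this,
    and the freed place holds the witnesses. The real changes only up to =_R, which is where the
    extensionality of Y on the reals is used. *)

Definition var_case (G : ctx) (t : ty) (P : forall s, var (t :: G) s -> Type)
    (a : P t vz) (f : forall s (y : var G s), P s (vs y)) :
    forall s x, P s x :=
  fun s x =>
    match x as x0 in var G' s' return
      match G' return var G' s' -> Type with
      | [::] => fun _ => unit
      | t' :: G'' => fun x0 =>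
          forall P : forall s, var (t' :: G'') s -> Type,
            P t' vz -> (forall s (y : var G'' s), P s (vs y)) -> P s' x0
      end x0
    with
    | vz _ _ => fun P a _ => a
    | vs _ _ _ y => fun P _ f => f _ y
    end P a f.

Lemma fun_var_ext (G : ctx) (P : ty -> Type) (f g : forall s, var G s -> P s) :
  (forall s x, f s x = g s x) -> f = g.
Proof. by move=> h; apply: functional_extensionality_dep => s; apply: funext. Qed.

Lemma fun_var_cons_ext (G : ctx) t (P : ty -> Type)
    (f g : forall s, var (t :: G) s -> P s) :
  f t vz = g t vz -> (forall s x, f s (vs x) = g s (vs x)) -> f = g.
Proof.
move=> h0 hS; apply: fun_var_ext => s x; move: s x.
exact: (var_case (P := fun s x => f s x = g s x)).
Qed.

(** The second premise is again an equality of functions on variables, so the lemma can be applied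
    once per entry of the context. *)
Lemma fun_var_cons_eq (G : ctx) t (P : ty -> Type)
    (f g : forall s, var (t :: G) s -> P s) :
  f t vz = g t vz ->
  (fun s (x : var G s) => f s (vs x)) = (fun s x => g s (vs x)) -> f = g.
Proof.
move=> h0 hS; apply: fun_var_cons_ext => // s x.
exact: (congr1 (fun h => h s x) hS).
Qed.

(** * Substitution calculus *)

Lemma tren_tren G D E (r : ren G D) (q : ren D E) s (a : tm G s) :
  tren q (tren r a) = tren (fun s x => q s (r s x)) a.
Proof. by elim: a => //= ? ? f -> a ->. Qed.

Lemma tren_tsub G (s : ty) (a : tm G s) D (r : ren G D) :
  tren r a = tsub (fun s x => tvar (r s x)) a.
Proof. by elim: a => //= ? ? f -> a ->. Qed.

Lemma tsub_tren G D E (r : ren G D) (q : sbs D E) s (a : tm G s) :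
  tsub q (tren r a) = tsub (fun s x => q s (r s x)) a.
Proof. by elim: a => //= ? ? f -> a ->. Qed.

Lemma tren_of_tsub G D E (r : sbs G D) (q : ren D E) s (a : tm G s) :
  tren q (tsub r a) = tsub (fun s x => tren q (r s x)) a.
Proof. by elim: a => //= ? ? f -> a ->. Qed.

Lemma tsub_tsub G D E (r : sbs G D) (q : sbs D E) s (a : tm G s) :
  tsub q (tsub r a) = tsub (fun s x => tsub q (r s x)) a.
Proof. by elim: a => //= ? ? f -> a ->. Qed.

Lemma tsub_id G s (a : tm G s) : tsub (fun s x => tvar x) a = a.
Proof. by elim: a => //= ? ? f -> a ->. Qed.

Lemma tren_id G s (a : tm G s) : tren (fun s x => x) a = a.
Proof. by rewrite tren_tsub tsub_id. Qed.

Lemma ups_upr G D t (r : ren G D) :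
  ups (t := t) (fun s x => tvar (r s x)) = fun s x => tvar (upr r x).
Proof. exact: fun_var_cons_ext. Qed.

Lemma ups_id G t : ups (t := t) (fun s (x : var G s) => tvar x) = fun s x => tvar x.
Proof. exact: fun_var_cons_ext. Qed.

Lemma tsub_ups_twk G D t (r : sbs G D) s (a : tm G s) :
  tsub (ups (t := t) r) (twk a) = twk (tsub r a).
Proof. by rewrite /twk tsub_tren tren_of_tsub. Qed.

Lemma ups_comp G D E t (r : sbs G D) (q : sbs D E) :
  (fun s x => tsub (ups (t := t) q) (ups r x)) = ups (fun s x => tsub q (r s x)).
Proof. by apply: fun_var_cons_ext => //= s x; apply: tsub_ups_twk. Qed.

Lemma fren_fsub G (A : fm G) D (r : ren G D) :
  fren r A = fsub (fun s x => tvar (r s x)) A.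
Proof.
elim: A D r => //=.
- by move=> ? t u D r; rewrite !tren_tsub.
- by move=> ? t u D r; rewrite !tren_tsub.
- by move=> ? A hA B hB D r; rewrite hA hB.
- by move=> ? A hA B hB D r; rewrite hA hB.
- by move=> ? A hA B hB D r; rewrite hA hB.
- by move=> ? s A hA D r; rewrite hA ups_upr.
- by move=> ? s A hA D r; rewrite hA ups_upr.
Qed.

Lemma fsub_fsub G (A : fm G) D E (r : sbs G D) (q : sbs D E) :
  fsub q (fsub r A) = fsub (fun s x => tsub q (r s x)) A.
Proof.
elim: A D E r q => //=.
- by move=> ? t u D E r q; rewrite !tsub_tsub.
- by move=> ? t u D E r q; rewrite !tsub_tsub.
- by move=> ? A hA B hB D E r q; rewrite hA hB.
- by move=> ? A hA B hB D E r q; rewrite hA hB.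
- by move=> ? A hA B hB D E r q; rewrite hA hB.
- by move=> ? s A hA D E r q; rewrite hA ups_comp.
- by move=> ? s A hA D E r q; rewrite hA ups_comp.
Qed.

Lemma fsub_id G (A : fm G) : fsub (fun s x => tvar x) A = A.
Proof.
elim: A => //=.
- by move=> ? t u; rewrite !tsub_id.
- by move=> ? t u; rewrite !tsub_id.
- by move=> ? A hA B hB; rewrite hA hB.
- by move=> ? A hA B hB; rewrite hA hB.
- by move=> ? A hA B hB; rewrite hA hB.
- by move=> ? s A hA; rewrite ups_id hA.
- by move=> ? s A hA; rewrite ups_id hA.
Qed.

Lemma fren_fren G (A : fm G) D E (r : ren G D) (q : ren D E) :
  fren q (fren r A) = fren (fun s x => q s (r s x)) A.
Proof. by rewrite !fren_fsub fsub_fsub. Qed.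

Lemma fren_id G (A : fm G) : fren (fun s x => x) A = A.
Proof. by rewrite fren_fsub fsub_id. Qed.

Lemma fren_of_fsub G D E (r : sbs G D) (q : ren D E) (A : fm G) :
  fren q (fsub r A) = fsub (fun s x => tren q (r s x)) A.
Proof.
rewrite fren_fsub fsub_fsub; congr (fsub _ A).
by apply: fun_var_ext => s x; rewrite tren_tsub.
Qed.

Lemma fsub_fren G D E (r : ren G D) (q : sbs D E) (A : fm G) :
  fsub q (fren r A) = fsub (fun s x => q s (r s x)) A.
Proof. by rewrite fren_fsub fsub_fsub. Qed.

Lemma fsub_inst G D s (r : sbs G D) (A : fm (s :: G)) (a : tm G s) :
  fsub r (inst A a) = inst (fsub (ups r) A) (tsub r a).
Proof.
rewrite /inst !fsub_fsub; congr (fsub _ A).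
apply: fun_var_cons_ext => //= t x.
by rewrite /twk tsub_tren /= tsub_id.
Qed.

Lemma fren_inst G D s (r : ren G D) (A : fm (s :: G)) (a : tm G s) :
  fren r (inst A a) = inst (fren (upr r) A) (tren r a).
Proof. by rewrite !fren_fsub fsub_inst ups_upr tren_tsub. Qed.

Lemma fren_fwk G D t (r : ren G D) (A : fm G) :
  fren (upr (t := t) r) (fwk t A) = fwk t (fren r A).
Proof. by rewrite /fwk !fren_fren. Qed.

Lemma fsub_eqT s G D (r : sbs G D) (x y : tm G s) :
  fsub r (eqT x y) = eqT (tsub r x) (tsub r y).
Proof.
by elim: s G D r x y => //= s hs t ht G D r x y; rewrite ht /= !tsub_ups_twk.
Qed.

Lemma fren_eqT s G D (r : ren G D) (x y : tm G s) :
  fren r (eqT x y) = eqT (tren r x) (tren r y).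
Proof. by rewrite fren_fsub fsub_eqT !tren_tsub. Qed.

Lemma qfree_fsub G D (r : sbs G D) (A : fm G) : qfree A -> qfree (fsub r A).
Proof.
elim: A D r => //=.
- by move=> ? A hA B hB D r [/hA h1 /hB h2].
- by move=> ? A hA B hB D r [/hA h1 /hB h2].
- by move=> ? A hA B hB D r [/hA h1 /hB h2].
Qed.

(** Needed twice: derivations must survive the addition of fresh witness variables, and in the term
    model an axiom is evaluated by substituting representatives for its variables. *)
Definition fsub_closed (T : theory) : Prop :=
  forall G D (r : sbs G D) (A : fm G), T G A -> T D (fsub r A).

Lemma QFAC_fsub s t : fsub_closed (QFAC s t).
Proof.
move=> G D r A h; case: G A / h D r => G A qA D r /=.
suff -> : fsub (ups (ups r))
    (fsub (vcase (v1 · v0)%tm (vcase v0 (fun _ x => tvar (vs (vs x))))) A)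
  = fsub (vcase (v1 · v0)%tm (vcase v0 (fun _ x => tvar (vs (vs x)))))
      (fsub (ups (ups r)) A).
  by apply: QFAC_ax; apply: qfree_fsub.
rewrite !fsub_fsub; congr (fsub _ A).
apply: fun_var_cons_eq => //; apply: fun_var_cons_eq => //.
apply: fun_var_ext => u x /=.
by rewrite /twk !tsub_tren /= tren_tren tren_tsub.
Qed.

(** Schemes over arbitrary terms are closed by their shape; only those over quantifier-free formulas
    require commuting the substitution with their own instantiations. *)
Lemma RCA0w_fsub : fsub_closed RCA0w.
Proof.
move=> G D r A h; case: G A / h D r => /=; intros;
  rewrite ?fsub_eqT /=; try by constructor.
- have -> : fsub (ups r) (inst (fwk1 N A) (v0 + cOne)%tm)
          = inst (fwk1 N (fsub (ups r) A)) (v0 + cOne)%tm.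
    rewrite fsub_inst /fwk1 fsub_fren fren_of_fsub /inst !fsub_fsub.
    congr (fsub _ A); apply: fun_var_cons_ext => //= s x.
    by rewrite /twk !tsub_tren.
  by rewrite fsub_inst; apply: QFInd; apply: qfree_fsub.
- by apply: QFAC10; apply: QFAC_fsub.
Qed.

Lemma RCA0w_QFAC01_fsub : fsub_closed RCA0w_QFAC01.
Proof.
by move=> G D r A [/RCA0w_fsub h|/QFAC_fsub h]; [left|right]; apply: h.
Qed.

(** * Structural properties of derivations *)

Lemma prf_incl (T : theory) G (H H' : list (fm G)) A :
  prf T H A -> List.incl H H' -> prf T H' A.
Proof.
move=> p; elim: p H'.
- by move=> *; apply: Ax.
- by move=> ? ? ? h ? i; apply: Hyp; apply: i.
- by move=> ? ? A' B _ h ? i; apply: ImpI; apply: h; apply: List.incl_cons; [left|apply: List.incl_tl].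
- by move=> ? ? A' B _ h _ h' ? i; apply: (ImpE (A := A')); auto.
- by move=> ? ? A' B _ h _ h' ? i; apply: AndI; auto.
- by move=> ? ? A' B _ h ? i; apply: AndE1; apply: h.
- by move=> ? ? A' B _ h ? i; apply: AndE2; apply: h.
- by move=> ? ? A' B _ h ? i; apply: OrI1; apply: h.
- by move=> ? ? A' B _ h ? i; apply: OrI2; apply: h.
- move=> ? ? A' B C _ h _ h1 _ h2 ? i; apply: OrE (h _ i) _ _.
  + by apply: h1; apply: List.incl_cons; [left|apply: List.incl_tl].
  + by apply: h2; apply: List.incl_cons; [left|apply: List.incl_tl].
- by move=> ? ? ? A' _ h ? i; apply: AllI; apply: h; apply: List.incl_map.
- by move=> ? ? ? A' a _ h ? i; apply: AllE; apply: h.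
- by move=> ? ? ? A' a _ h ? i; apply: ExI; apply: h.
- move=> ? ? ? A' C _ h _ h' ? i; apply: ExE (h _ i) _; apply: h'.
  by apply: List.incl_cons; [left|apply: List.incl_tl; apply: List.incl_map].
- by move=> ? ? A' _ h ? i; apply: RAA; apply: h; apply: List.incl_cons; [left|apply: List.incl_tl].
- by move=> *; apply: EqRefl.
- by move=> ? ? A' t u _ h _ h' ? i; apply: (EqSubst (t := t)); auto.
Qed.

Lemma prf_fren (T : theory) (hT : fsub_closed T) G (H : list (fm G)) A :
  prf T H A -> forall D (r : ren G D), prf T (List.map (fren r) H) (fren r A).
Proof.
(* The quantifier rules weaken the hypotheses, so the renaming has to commute with that
   weakening. *)
have mw G0 D s (r : ren G0 D) H0 :
    List.map (fren (upr (t := s) r)) (List.map (fwk s) H0) =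
    List.map (fwk s) (List.map (fren r) H0).
  by rewrite !List.map_map; apply: List.map_ext => B; apply: fren_fwk.
elim=> {G H A} /=.
- by move=> ? ? A tA D r; apply: Ax; rewrite fren_fsub; apply: hT.
- by move=> ? ? A iA D r; apply: Hyp; apply: List.in_map.
- by move=> ? ? A B _ h D r; apply: ImpI; apply: h.
- by move=> ? ? A B _ h _ h' D r; apply: ImpE (h D r) (h' D r).
- by move=> ? ? A B _ h _ h' D r; apply: AndI.
- by move=> ? ? A B _ h D r; apply: AndE1 (h D r).
- by move=> ? ? A B _ h D r; apply: AndE2 (h D r).
- by move=> ? ? A B _ h D r; apply: OrI1.
- by move=> ? ? A B _ h D r; apply: OrI2.
- by move=> ? ? A B C _ h _ h1 _ h2 D r; apply: OrE (h D r) (h1 D r) (h2 D r).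
- by move=> ? ? s A _ h D r; apply: AllI; rewrite -mw; apply: h.
- by move=> ? ? s A a _ h D r; rewrite fren_inst; apply: AllE; apply: h.
- by move=> ? ? s A a _ h D r; apply: (ExI (a := tren r a)); rewrite -fren_inst.
- move=> ? ? s A C _ h _ h' D r; apply: ExE (h D r) _.
  by rewrite -mw -fren_fwk; apply: h'.
- by move=> ? ? A _ h D r; apply: RAA; apply: h.
- by move=> ? ? t D r; apply: EqRefl.
- move=> ? ? A t u _ h _ h' D r; rewrite fren_inst.
  by apply: EqSubst (h D r) _; rewrite -fren_inst.
Qed.

(** * Models *)

(** An applicative structure, with no demand that all functions exist. By [ap_ext] the defined
    equality [eqT] is interpreted as identity. *)
Record model := Model {
  dom :> ty -> Type;
  ap : forall s t, dom (Arr s t) -> dom s -> dom t;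
  ap_ext : forall s t (f g : dom (Arr s t)), (forall x, ap f x = ap g x) -> f = g;
  mZero : dom N;
  mOne : dom N;
  mAdd : dom (Arr N (Arr N N));
  mMul : dom (Arr N (Arr N N));
  mPi : forall s t, dom (Arr s (Arr t s));
  mSig : forall r s t,
    dom (Arr (Arr r (Arr s t)) (Arr (Arr r s) (Arr r t)));
  mRec : dom (Arr (Arr N (Arr N N)) (Arr N (Arr N N)));
  mLt : dom N -> dom N -> Prop }.

Definition env (M : model) (G : ctx) := forall s, var G s -> M s.

Definition econs (M : model) G s (a : M s) (e : env M G) : env M (s :: G) :=
  vcase a e.

Fixpoint ev (M : model) G (e : env M G) s (a : tm G s) : M s :=
  match a with
  | tvar _ x => e _ x
  | app _ _ f a => ap (ev e f) (ev e a)
  | cZero => mZero M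
  | cOne => mOne M
  | cAdd => mAdd M
  | cMul => mMul M
  | cPi s t => mPi M s t
  | cSig r s t => mSig M r s t
  | cRec => mRec M
  end.

Fixpoint sat (M : model) G (e : env M G) (A : fm G) : Prop :=
  match A with
  | Eq0 t u => ev e t = ev e u
  | Lt0 t u => mLt (ev e t) (ev e u)
  | Bot => False
  | Imp A B => sat e A -> sat e B
  | And A B => sat e A /\ sat e B
  | Or A B => sat e A \/ sat e B
  | All s A => forall a : M s, sat (econs a e) A
  | Ex s A => exists a : M s, sat (econs a e) A
  end.

Definition models (T : theory) (M : model) : Prop :=
  forall G (A : fm G), T G A -> forall e : env M G, sat e A.

Section Semantics.
Variable M : model.

Lemma ev_tren G D (r : ren G D) (e : env M D) s (a : tm G s) :
  ev e (tren r a) = ev (fun s x => e s (r s x)) a.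
Proof. by elim: a => //= ? ? f -> a ->. Qed.

Lemma ev_tsub G D (r : sbs G D) (e : env M D) s (a : tm G s) :
  ev e (tsub r a) = ev (fun s x => ev e (r s x)) a.
Proof. by elim: a => //= ? ? f -> a ->. Qed.

Lemma ev_twk G (e : env M G) t (b : M t) s (a : tm G s) :
  ev (econs b e) (twk a) = ev e a.
Proof. by rewrite /twk ev_tren. Qed.

Lemma econs_ups G D (r : sbs G D) (e : env M D) t (b : M t) :
  (fun s x => ev (econs b e) (ups r x)) = econs b (fun s x => ev e (r s x)).
Proof. by apply: fun_var_cons_ext => //= s x; apply: ev_twk. Qed.

Lemma sat_fsub G (A : fm G) D (r : sbs G D) (e : env M D) :
  sat e (fsub r A) = sat (fun s x => ev e (r s x)) A.
Proof.
elim: A D r e => //=.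
- by move=> ? t u D r e; rewrite !ev_tsub.
- by move=> ? t u D r e; rewrite !ev_tsub.
- by move=> ? A hA B hB D r e; rewrite hA hB.
- by move=> ? A hA B hB D r e; rewrite hA hB.
- by move=> ? A hA B hB D r e; rewrite hA hB.
- by move=> ? s A hA D r e; apply: eq_forall => a; rewrite hA econs_ups.
- by move=> ? s A hA D r e; apply: eq_exists => a; rewrite hA econs_ups.
Qed.

Lemma sat_fren G D (r : ren G D) (A : fm G) (e : env M D) :
  sat e (fren r A) = sat (fun s x => e s (r s x)) A.
Proof. by rewrite fren_fsub sat_fsub. Qed.

Lemma sat_inst G s (A : fm (s :: G)) (a : tm G s) (e : env M G) :
  sat e (inst A a) = sat (econs (ev e a) e) A.
Proof.
by rewrite /inst sat_fsub; congr (sat _ A); apply: fun_var_cons_ext.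
Qed.

Lemma sat_fwk1 G s t (A : fm (s :: G)) (e : env M G) (a : M s) (b : M t) :
  sat (econs a (econs b e)) (fwk1 t A) = sat (econs a e) A.
Proof.
by rewrite /fwk1 sat_fren; congr (sat _ A); apply: fun_var_cons_ext.
Qed.

Lemma sat_eqT s G (e : env M G) (x y : tm G s) :
  sat e (eqT x y) = (ev e x = ev e y).
Proof.
elim: s G e x y => //= s hs t ht G e x y; apply: propext; split => h.
  by apply: ap_ext => a; have := h a; rewrite ht /= !ev_twk.
by move=> a; rewrite ht /= !ev_twk h.
Qed.

End Semantics.

(** * Weakenings *)

Fixpoint idx (G : ctx) s (x : var G s) : nat :=
  match x with vz _ _ => 0 | vs _ _ _ y => (idx y).+1 end.

Lemma idx_inj G s (x y : var G s) : idx x = idx y -> x = y.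
Proof.
elim: G s x y => [|t G hG] s x; first by inversion x.
pose P s (x : var (t :: G) s) := forall y, idx x = idx y -> x = y.
move: s x; apply: (var_case (P := P)) => [y h|s x y h].
  (* The case analysis on [y] needs a free type index, hence the transport along [e]; at t = t it is
     trivial by proof irrelevance. *)
  pose Q s (y : var (t :: G) s) :=
    forall e : t = s, 0 = idx y -> eq_rect t (var (t :: G)) vz s e = y.
  apply: (var_case (P := Q) _ _ y erefl h) => // e _.
  by rewrite (Prop_irrelevance e erefl).
pose Q s (y : var (t :: G) s) :=
  forall x : var G s, (idx x).+1 = idx y -> vs x = y.
by apply: (var_case (P := Q) _ _ y x h) => // s1 y1 x1 [/hG ->].
Qed.

(** The embedding of a context as a final segment of another one. *)
Definition suffix_ren (G D : ctx) (r : ren G D) : Prop :=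
  forall s (x : var G s), idx (r s x) + size G = idx x + size D.

(** Thanks to this, embeddings between stages need not be chosen coherently. *)
Lemma suffix_ren_uniq G D (r q : ren G D) :
  suffix_ren r -> suffix_ren q -> r = q.
Proof.
move=> hr hq; apply: fun_var_ext => s x; apply: idx_inj.
by apply: (@addIn (size G)); rewrite hr hq.
Qed.

Lemma suffix_ren_id G : suffix_ren (fun s (x : var G s) => x).
Proof. by []. Qed.

Lemma suffix_ren_comp G D E (r : ren G D) (q : ren D E) :
  suffix_ren r -> suffix_ren q -> suffix_ren (fun s x => q s (r s x)).
Proof.
move=> hr hq s x; apply: (@addIn (size D)).
by rewrite addnAC hq addnAC hr addnAC.
Qed.

Lemma suffix_ren_vs G D (r : ren G D) t :
  suffix_ren r -> suffix_ren (fun s x => @vs D s t (r s x)).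
Proof. by move=> hr s x; rewrite /= addSn hr addnS. Qed.

(** * Countability of formulas *)

Fixpoint ty_code (s : ty) : GenTree.tree nat :=
  match s with
  | N => GenTree.Leaf 0
  | Arr s t => GenTree.Node 0 [:: ty_code s; ty_code t]
  end.

Lemma ty_code_inj : injective ty_code.
Proof. by elim=> [|s hs t ht] [|s' t'] //= [/hs -> /ht ->]. Qed.

Definition ctx_code (G : ctx) : GenTree.tree nat :=
  GenTree.Node 0 (map ty_code G).

(** Context and type are stored at every node, so that equal codes force equal dependent indices. *)
Definition tm_shape_code (k : nat) (G : ctx) s l : GenTree.tree nat :=
  GenTree.Node k [:: ctx_code G, ty_code s & l].

Fixpoint tm_code (G : ctx) s (a : tm G s) : GenTree.tree nat :=
  match a with
  | tvar s x => tm_shape_code 0 G s [:: GenTree.Leaf (idx x)]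
  | app s t f a => tm_shape_code 1 G t [:: tm_code f; tm_code a]
  | cZero => tm_shape_code 2 G N [::]
  | cOne => tm_shape_code 3 G N [::]
  | cAdd => tm_shape_code 4 G (Arr N (Arr N N)) [::]
  | cMul => tm_shape_code 5 G (Arr N (Arr N N)) [::]
  | cPi s t => tm_shape_code 6 G (Arr s (Arr t s)) [::]
  | cSig r s t =>
      tm_shape_code 7 G (Arr (Arr r (Arr s t)) (Arr (Arr r s) (Arr r t))) [::]
  | cRec => tm_shape_code 8 G (Arr (Arr N (Arr N N)) (Arr N (Arr N N))) [::]
  end.

Definition tm_any := {G : ctx & {s : ty & tm G s}}.
Definition tm_pack G s (a : tm G s) : tm_any := existT _ G (existT _ s a).

Lemma tm_pack_inj G s (a b : tm G s) : tm_pack a = tm_pack b -> a = b.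
Proof.
(* Classically every equality is decidable, which makes dependent pairs injective in their second
   component. *)
have dec T (x y : T) : {x = y} + {x <> y} by apply: pselect.
move=> h; have {}h := Eqdep_dec.inj_pair2_eq_dec _ (@dec _) _ _ _ _ h.
exact: Eqdep_dec.inj_pair2_eq_dec _ (@dec _) _ _ _ _ h.
Qed.

Lemma tm_pack_ty G s t (a : tm G s) (b : tm G t) :
  tm_pack a = tm_pack b -> s = t.
Proof. by move=> /(congr1 (fun p => projT1 (projT2 p))). Qed.

(** Stated across contexts and types because the argument type of an application is not stored at
    its node; it is recovered from the code of the argument. *)
Lemma tm_code_inj G s (a : tm G s) G' s' (b : tm G' s') :
  tm_code a = tm_code b -> tm_pack a = tm_pack b.
Proof.
elim: a G' s' b => {s} [s x|s t f hf a ha| | | | |s t|r s t| ] G' s' [] //=.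
- move=> s0 x0 [/(inj_map ty_code_inj) eG /ty_code_inj es]; subst G' s0.
  by move=> /idx_inj ->.
- move=> s0 t0 f0 a0 [/(inj_map ty_code_inj) eG /ty_code_inj es]; subst G' t0.
  move=> /hf ef /ha ea; have es := tm_pack_ty ea; subst s0.
  by rewrite (tm_pack_inj ef) (tm_pack_inj ea).
- by move=> [/(inj_map ty_code_inj) ->].
- by move=> [/(inj_map ty_code_inj) ->].
- by move=> [/(inj_map ty_code_inj) ->].
- by move=> [/(inj_map ty_code_inj) ->].
- by move=> s0 t0 [/(inj_map ty_code_inj) -> /ty_code_inj -> /ty_code_inj ->].
- move=> r0 s0 t0 [/(inj_map ty_code_inj) -> /ty_code_inj -> /ty_code_inj ->].
  by move=> /ty_code_inj -> //.
- by move=> [/(inj_map ty_code_inj) ->].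
Qed.

Definition fm_shape_code (k : nat) (G : ctx) l : GenTree.tree nat :=
  GenTree.Node k (ctx_code G :: l).

Fixpoint fm_code (G : ctx) (A : fm G) : GenTree.tree nat :=
  match A with
  | Eq0 t u => fm_shape_code 0 G [:: tm_code t; tm_code u]
  | Lt0 t u => fm_shape_code 1 G [:: tm_code t; tm_code u]
  | Bot => fm_shape_code 2 G [::]
  | Imp A B => fm_shape_code 3 G [:: fm_code A; fm_code B]
  | And A B => fm_shape_code 4 G [:: fm_code A; fm_code B]
  | Or A B => fm_shape_code 5 G [:: fm_code A; fm_code B]
  | All s A => fm_shape_code 6 G [:: ty_code s; fm_code A]
  | Ex s A => fm_shape_code 7 G [:: ty_code s; fm_code A]
  end.

Lemma fm_code_inj G (A : fm G) (B : fm G) : fm_code A = fm_code B -> A = B.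
Proof.
elim: A B => {G} [G t u|G t u|G|G A hA B hB|G A hA B hB|G A hA B hB|G s A hA|G s A hA]
  [] //=.
- by move=> t' u' [/tm_code_inj/tm_pack_inj -> /tm_code_inj/tm_pack_inj ->].
- by move=> t' u' [/tm_code_inj/tm_pack_inj -> /tm_code_inj/tm_pack_inj ->].
- by move=> A' B' [/hA -> /hB ->].
- by move=> A' B' [/hA -> /hB ->].
- by move=> A' B' [/hA -> /hB ->].
- by move=> s' A' [/ty_code_inj es]; subst s' => /hA ->.
- by move=> s' A' [/ty_code_inj es]; subst s' => /hA ->.
Qed.

Lemma fm_code_ctx G D (A : fm G) (B : fm D) : fm_code A = fm_code B -> G = D.
Proof. by case: A; case: B => //= > [/(inj_map ty_code_inj)]. Qed.

(** Every formula recurs beyond any bound: its context may embed only into late stages, and it has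
    to be treated at one of those. *)
Lemma fm_enumeration :
  exists f : nat -> option {G : ctx & fm G},
    forall G (A : fm G) m, exists2 n, m <= n & f n = Some (existT _ G A).
Proof.
pose P n (X : {G : ctx & fm G}) := pickle (fm_code (projT2 X)) = n.
pose f n := if pselect (exists X, P n X) is left h then Some (projT1 (cid h))
            else None.
(* Reading an index through its exponent of 2 leaves the exponent of 3 free, so each value is
   attained arbitrarily late. *)
exists (fun n => f (logn 2 n)) => G A m.
exists (2 ^ pickle (fm_code A) * 3 ^ m).
  apply: leq_trans (leq_pmull _ _); last by rewrite expn_gt0.
  by apply: ltnW; apply: ltn_expl.
have l23 : logn 2 3 = 0 by [].
rewrite lognM ?expn_gt0 // pfactorK // lognX l23 muln0 addn0.
rewrite /f; case: pselect => [h|[]]; last by exists (existT _ G A).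
case: (cid h) => -[D B] /(pcan_inj pickleK) /= e; congr Some.
by have /= e' := fm_code_ctx e; subst D; rewrite (fm_code_inj e).
Qed.

(** * Completeness for extensional models *)

Lemma prf_cut (T : theory) G (L H : list (fm G)) A :
  (forall B, List.In B L -> prf T H B) -> prf T L A -> prf T H A.
Proof.
elim: L A => [|B L hL] A h p; first by apply: prf_incl p _ => ? [].
apply: ImpE (h B (or_introl erefl)); apply: hL; last exact: ImpI.
by move=> C hC; apply: h; right.
Qed.

Lemma tsub_vcase_twk G D s t (a : tm D t) (f : sbs G D) (b : tm G s) :
  tsub (vcase a f) (twk b) = tsub f b.
Proof. by rewrite /twk tsub_tren. Qed.

Lemma inst_fren_ups G D E s (sb : sbs G D) (r : ren D E) (A : fm (s :: G))
    (t : tm E s) :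
  inst (fren (upr r) (fsub (ups sb) A)) t =
  fsub (vcase t (fun u x => tren r (sb u x))) A.
Proof.
rewrite /inst fsub_fren fsub_fsub; congr (fsub _ A).
by apply: fun_var_cons_ext => //= u x; rewrite /twk tsub_tren tren_tsub.
Qed.

Lemma inst_fren_upr_v0 G D s (q : ren G D) (B : fm (s :: G)) :
  inst (fren (upr (fun u x => @vs D u s (q u x))) B) v0 = fren (upr q) B.
Proof.
rewrite /inst !fren_fsub fsub_fsub; congr (fsub _ B).
exact: fun_var_cons_ext.
Qed.

(** * The sequence of consistent states *)

Record state := State { sctx : ctx; shyp : list (fm sctx) }.

Section Henkin.
Variable T : theory.
Hypothesis T_sub : fsub_closed T.
Hypothesis T_ext : forall G s t (x y : tm G s) (f : tm G (Arr s t)),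
  T (Imp (eqT x y) (eqT (app f x) (app f y))).
Variable C0 : fm [::].
Hypothesis unprov : ~ prf T [::] C0.

Definition consistent (S : state) : Prop := ~ prf T (shyp S) Bot.

(** At most one such [q] exists; when there is none, nothing is required. *)
Definition decides (D : ctx) (A : fm D) (S : state) : Prop :=
  forall q : ren D (sctx S), suffix_ren q ->
    prf T (shyp S) (fren q A) \/ prf T (shyp S) (Imp (fren q A) Bot).

Definition witnesses (D : ctx) (A : fm D) (S : state) : Prop :=
  forall s (B : fm (s :: D)), A = Ex s B ->
  forall q : ren D (sctx S), suffix_ren q ->
    prf T (shyp S) (fren q A) ->
    exists t, prf T (shyp S) (inst (fren (upr q) B) t).

Definition extends (S S' : state) : Prop :=
  exists2 r : ren (sctx S) (sctx S'),
    suffix_ren r & List.incl (List.map (fren r) (shyp S)) (shyp S').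

Lemma extends_refl S : extends S S.
Proof.
exists (fun s x => x) => // A /List.in_map_iff [B [<- hB]].
by rewrite fren_id.
Qed.

Lemma extends_trans S1 S2 S3 : extends S1 S2 -> extends S2 S3 -> extends S1 S3.
Proof.
case=> r hr ir [q hq iq]; exists (fun s x => q s (r s x)).
  exact: suffix_ren_comp.
move=> A /List.in_map_iff [B [<- hB]]; rewrite -fren_fren.
by apply: iq; apply: List.in_map; apply: ir; apply: List.in_map.
Qed.

(** If [A] embeds and is consistent with [S], add it, together with an instance at a fresh variable
    when it is existential. If it is inconsistent with [S], it is already refutable and nothing is
    added. *)
Lemma step_ex (S : state) (X : option {D : ctx & fm D}) : consistent S ->
  exists S', [/\ consistent S', extends S S' &
    forall D (A : fm D) (q : ren D (sctx S)), X = Some (existT _ D A) ->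
      suffix_ren q -> decides A S' /\ witnesses A S'].
Proof.
move=> cS.
have [[D [A [q [-> hq]]]]|none] := pselect (exists D (A : fm D)
    (q : ren D (sctx S)), X = Some (existT _ D A) /\ suffix_ren q); last first.
  exists S; split=> //; first exact: extends_refl.
  by move=> D A q e hq; case: none; exists D, A, q.
suff [S' [c' e' d' w']] : exists S', [/\ consistent S', extends S S',
    decides A S' & witnesses A S'].
  exists S'; split=> // D' A' q' [e]; subst D' => eA _.
  have dec (x y : ctx) : {x = y} + {x <> y} by apply: pselect.
  by rewrite -(Eqdep_dec.inj_pair2_eq_dec _ dec _ _ _ _ eA).
have [pb|npb] := pselect (prf T (fren q A :: shyp S) Bot).
  exists S; split=> //; first exact: extends_refl.
    move=> q' hq'; right; apply: ImpI.
    by rewrite (suffix_ren_uniq hq' hq).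
  move=> s B _ q' hq'; rewrite (suffix_ren_uniq hq' hq) => p.
  by case: cS; apply: ImpE p; apply: ImpI.
have [[s [B eA]]|nEx] := pselect (exists s (B : fm (s :: D)), A = Ex s B).
  have sq := suffix_ren_vs s hq.
  exists (State (fren (upr q) B :: List.map (fwk s) (fren q A :: shyp S))).
  split=> /=.
  (* A contradiction from the fresh instance would, by elimination of the existential, refute [A]
     itself. *)
  - move=> p; apply: npb; apply: (ExE (s := s) (A := fren (upr q) B)).
      by apply: Hyp; left; rewrite eA.
    exact: p.
  - exists (fun _ x => vs x); first exact: (suffix_ren_vs s (@suffix_ren_id _)).
    by move=> /= E hE; right; right.
  - move=> q' hq'; left; apply: Hyp; right; left => /=.
    by rewrite (suffix_ren_uniq hq' sq) /fwk fren_fren.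
  - move=> s' B'; rewrite eA => -[es]; subst s' => eB q' hq' _.
    have dec (x y : ty) : {x = y} + {x <> y} by apply: pselect.
    have := Eqdep_dec.inj_pair2_eq_dec _ dec _ _ _ _ eB => <-.
    exists v0; apply: Hyp; left.
    by rewrite (suffix_ren_uniq hq' sq) inst_fren_upr_v0.
exists (State (fren q A :: shyp S)); split=> //.
- exists (fun s x => x) => // E /List.in_map_iff [B [<- hB]].
  by rewrite fren_id; right.
- by move=> q' hq'; left; apply: Hyp; left; rewrite (suffix_ren_uniq hq' hq).
- by move=> s B e; case: nEx; exists s, B.
Qed.

Definition enum_fm := projT1 (cid fm_enumeration).

Definition cstate := {S : state | consistent S}.

Definition step (n : nat) (S : cstate) : cstate :=
  let h := cid (step_ex (enum_fm n) (proj2_sig S)) in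
  exist _ (projT1 h) (let: And3 c _ _ := projT2 h in c).

Lemma start_consistent : consistent (@State [::] [:: Imp C0 Bot]).
Proof. by move=> p; apply: unprov; apply: RAA. Qed.

Fixpoint stage (n : nat) : cstate :=
  match n with
  | 0 => exist _ _ start_consistent
  | S n => step n (stage n)
  end.

(** * Truth as provability at some stage *)

Local Notation st n := (proj1_sig (stage n)).
Local Notation cx n := (sctx (st n)).
Local Notation hy n := (shyp (st n)).

Lemma st_ext n m : n <= m -> extends (st n) (st m).
Proof.
elim: m => [|m hm]; first by rewrite leqn0 => /eqP ->; apply: extends_refl.
rewrite leq_eqVlt => /orP [/eqP ->|/hm h]; first exact: extends_refl.
apply: extends_trans h _; rewrite /= /step.
by case: (cid _) => S' [].
Qed.

Lemma cx_ren n m : n <= m -> exists r : ren (cx n) (cx m), suffix_ren r.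
Proof. by case/st_ext => r hr _; exists r. Qed.

Definition holds n (A : fm (cx n)) : Prop :=
  exists m (r : ren (cx n) (cx m)), suffix_ren r /\ prf T (hy m) (fren r A).

Lemma prf_later n m (r : ren (cx n) (cx m)) (A : fm (cx n)) :
  n <= m -> suffix_ren r -> prf T (hy n) A -> prf T (hy m) (fren r A).
Proof.
case/st_ext => q hq iq hr; rewrite (suffix_ren_uniq hr hq) => p.
exact: prf_incl (prf_fren T_sub p q) iq.
Qed.

Lemma holds_later n (A : fm (cx n)) : holds A -> exists2 m0, n <= m0 &
  forall m (r : ren (cx n) (cx m)), m0 <= m -> suffix_ren r ->
    prf T (hy m) (fren r A).
Proof.
case=> m [r [hr p]]; exists (maxn n m); first exact: leq_maxl.
move=> k q; rewrite geq_max => /andP [_ mk] hq.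
have [u hu] := cx_ren mk.
by rewrite (suffix_ren_uniq hq (suffix_ren_comp hr hu)) -fren_fren; apply: prf_later.
Qed.

Lemma holds_ren n m (r : ren (cx n) (cx m)) (A : fm (cx n)) : suffix_ren r ->
  holds (fren r A) <-> holds A.
Proof.
move=> hr; split=> [[k [q [hq p]]]|/holds_later [m0 _ h]].
  exists k, (fun s x => q s (r s x)); split; last by rewrite -fren_fren.
  exact: suffix_ren_comp.
have [q hq] := cx_ren (leq_maxr m0 m).
exists (maxn m0 m), q; split=> //; rewrite fren_fren; apply: h.
  exact: leq_maxl.
exact: suffix_ren_comp.
Qed.

Lemma holds_prf n (L : list (fm (cx n))) A :
  (forall B, List.In B L -> holds B) -> prf T L A -> holds A.
Proof.
move=> hL p.
suff [m0 nm h] : exists2 m0, n <= m0 & forall m (r : ren (cx n) (cx m)),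
    m0 <= m -> suffix_ren r -> forall B, List.In B L -> prf T (hy m) (fren r B).
  have [r hr] := cx_ren nm; exists m0, r; split=> //.
  apply: prf_cut (prf_fren T_sub p r) => _ /List.in_map_iff [B [<- hB]].
  exact: h.
elim: L {p} hL => [|B L IH] hL; first by exists n.
have [m0 nm0 h0] := IH (fun B hB => hL B (or_intror hB)).
have [m1 nm1 h1] := holds_later (hL B (or_introl erefl)).
exists (maxn m0 m1); first by rewrite leq_max nm0.
move=> m r; rewrite geq_max => /andP [l0 l1] hr C [<-|hC]; [exact: h1|exact: h0].
Qed.

Lemma holds_prf1 n (A B : fm (cx n)) : prf T [:: A] B -> holds A -> holds B.
Proof. by move=> p h; apply: holds_prf p => C [<-|[]]. Qed.

Lemma holds_prf2 n (A B C : fm (cx n)) :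
  prf T [:: A; B] C -> holds A -> holds B -> holds C.
Proof. by move=> p hA hB; apply: holds_prf p => D [<-|[<-|[]]]. Qed.

Lemma holds_ax n (A : fm (cx n)) : T A -> holds A.
Proof. by move=> h; apply: (@holds_prf n [::]) => //; apply: Ax. Qed.

Lemma holds_cons n : ~ holds (Bot : fm (cx n)).
Proof. by case=> m [r [_]]; apply: (proj2_sig (stage m)). Qed.

(** Uses an occurrence of [A] in the enumeration beyond [n], where its context is known to embed. *)
Lemma stage_spec n (A : fm (cx n)) : exists2 m, n <= m &
  decides A (st m) /\ witnesses A (st m).
Proof.
have := projT2 (cid fm_enumeration) (cx n) A n; rewrite -/enum_fm => -[m nm e].
have [r hr] := cx_ren nm.
exists m.+1; first exact: leqW.
rewrite /= /step; case: (cid _) => S' [/= _ _ h].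
exact: (h _ A r e hr).
Qed.

Lemma holds_compl n (A : fm (cx n)) : holds A \/ holds (Imp A Bot).
Proof.
have [m nm [d _]] := stage_spec A; have [r hr] := cx_ren nm.
by case: (d _ hr) => p; [left|right]; exists m, r.
Qed.

(** At a stage that treats the existential, a refutation of it would contradict [holds]; so it is
    provable there and has received a witness. *)
Lemma holds_wit n s (B : fm (s :: cx n)) : holds (Ex s B) ->
  exists m (r : ren (cx n) (cx m)) t,
    suffix_ren r /\ holds (inst (fren (upr r) B) t).
Proof.
move=> h.
have [m nm [d w]] := stage_spec (Ex s B); have [r hr] := cx_ren nm.
have p : prf T (hy m) (fren r (Ex s B)).
  case: (d _ hr) => // p; case: (@holds_cons n).
  apply: holds_prf2 h (_ : holds (Imp (Ex s B) Bot)); last by exists m, r.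
  by apply: (ImpE (A := Ex s B)); apply: Hyp; [right; left|left].
have [t pt] := w s B erefl r hr p.
exists m, r, t; split=> //; exists m, (fun s x => x).
by rewrite fren_id.
Qed.

Lemma holds_ex n s (B : fm (s :: cx n)) : holds (Ex s B) <->
  exists m (r : ren (cx n) (cx m)) t,
    suffix_ren r /\ holds (inst (fren (upr r) B) t).
Proof.
split; first exact: holds_wit.
case=> m [r [t [hr h]]]; apply/(holds_ren _ hr) => /=.
by apply: holds_prf1 h; apply: (ExI (a := t)); apply: Hyp; left.
Qed.

Lemma holds_imp n (A B : fm (cx n)) : holds (Imp A B) <-> (holds A -> holds B).
Proof.
split=> [h hA|h].
  apply: holds_prf2 h hA.
  by apply: (ImpE (A := A)); apply: Hyp; [left|right; left].
have [/h hB|hA] := holds_compl A.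
  by apply: holds_prf1 hB; apply: ImpI; apply: Hyp; right; left.
apply: holds_prf1 hA; apply: ImpI; apply: RAA.
by apply: (ImpE (A := A)); apply: Hyp; [right; right; left|right; left].
Qed.

Lemma holds_and n (A B : fm (cx n)) : holds (And A B) <-> holds A /\ holds B.
Proof.
split=> [h|[hA hB]].
  split; apply: holds_prf1 h; first by apply: (AndE1 (B := B)); apply: Hyp; left.
  by apply: (AndE2 (A := A)); apply: Hyp; left.
by apply: holds_prf2 hA hB; apply: AndI; apply: Hyp; [left|right; left].
Qed.

Lemma holds_or n (A B : fm (cx n)) : holds (Or A B) <-> holds A \/ holds B.
Proof.
split=> [h|[h|h]]; last 2 first.
- by apply: holds_prf1 h; apply: OrI1; apply: Hyp; left.
- by apply: holds_prf1 h; apply: OrI2; apply: Hyp; left.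
have [hA|nA] := holds_compl A; first by left.
right; apply: holds_prf2 h nA; apply: (OrE (A := A) (B := B)).
- by apply: Hyp; left.
- apply: RAA; apply: (ImpE (A := A)); apply: Hyp; last by right; left.
  by right; right; right; left.
- by apply: Hyp; left.
Qed.

(** Instances at all later stages are needed, because new terms keep appearing. If the universal
    formula fails, then classically some counterexample exists, and its Henkin witness contradicts
    the instances. *)
Lemma holds_all n s (A : fm (s :: cx n)) : holds (All s A) <->
  forall m (r : ren (cx n) (cx m)) t,
    suffix_ren r -> holds (inst (fren (upr r) A) t).
Proof.
split=> [h m r t hr|h].
  move/(holds_ren _ hr): h => /=; apply: holds_prf1.
  by apply: AllE; apply: Hyp; left.
have [//|nA] := holds_compl (All s A).
suff /holds_wit [m [r [t [hr]]]] : holds (Ex s (Imp A Bot)).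
  rewrite [fren _ _]/= [inst _ _]/= => h'.
  case: (@holds_cons m); move/holds_imp: h'; apply; exact: h.
apply: holds_prf1 nA; apply: RAA.
apply: (ImpE (A := All s A)); first by apply: Hyp; right; left.
apply: AllI => /=; apply: RAA.
apply: (ImpE (A := fwk s (Ex s (Imp A Bot)))).
  by apply: Hyp; right; left.
rewrite /fwk /=; apply: (ExI (a := v0)).
have -> : inst (Imp (fren (upr (fun u x => vs x)) A) Bot) v0 = Imp A Bot.
  rewrite [inst _ _]/=; congr Imp.
  apply: etrans (fsub_fren _ _ A) _; rewrite -[RHS]fsub_id; congr (fsub _ A).
  exact: fun_var_cons_ext.
by apply: Hyp; left.
Qed.

(** * Provable equality as a congruence *)

Lemma holds_eqT_arrow n s t (x y : tm (cx n) (Arr s t)) : holds (eqT x y) <->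
  forall m (r : ren (cx n) (cx m)) a,
    suffix_ren r -> holds (eqT (app (tren r x) a) (app (tren r y) a)).
Proof.
have e m (r : ren (cx n) (cx m)) (a : tm (cx m) s) :
    inst (fren (upr r) (eqT (app (twk x) v0) (app (twk y) v0))) a =
    eqT (app (tren r x) a) (app (tren r y) a).
  rewrite fren_eqT /inst fsub_eqT /= !tren_tsub !tsub_tsub.
  by rewrite /twk !tsub_tren.
split=> [/holds_all h m r a hr|h].
  by rewrite -e; apply: h.
by apply/holds_all => m r a hr; rewrite e; apply: h.
Qed.

Lemma holds_eqT_refl n s (x : tm (cx n) s) : holds (eqT x x).
Proof.
elim: s n x => [|s _ t ht] n x.
  by apply: (@holds_prf n [::]) => //; apply: EqRefl.
by apply/holds_eqT_arrow => m r a _; apply: ht.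
Qed.

Lemma holds_eqT_sym n s (x y : tm (cx n) s) : holds (eqT x y) -> holds (eqT y x).
Proof.
elim: s n x y => [|s _ t ht] n x y.
  apply: holds_prf1; have := @EqSubst T _ [:: Eq0 x y] (Eq0 v0 (twk x)) x y.
  rewrite /inst /= !tsub_vcase_twk !tsub_id; apply; last exact: EqRefl.
  by apply: Hyp; left.
by move=> /holds_eqT_arrow h; apply/holds_eqT_arrow => m r a hr; apply/ht/h.
Qed.

Lemma holds_eqT_trans n s (x y z : tm (cx n) s) :
  holds (eqT x y) -> holds (eqT y z) -> holds (eqT x z).
Proof.
elim: s n x y z => [|s _ t ht] n x y z.
  move=> h h'; apply: holds_prf2 h h'.
  have := @EqSubst T _ [:: Eq0 x y; Eq0 y z] (Eq0 (twk x) v0) y z.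
  rewrite /inst /= !tsub_vcase_twk !tsub_id; apply; apply: Hyp.
    by right; left.
  by left.
move=> /holds_eqT_arrow h /holds_eqT_arrow h'.
by apply/holds_eqT_arrow => m r a hr; apply: (ht _ _ _ _ (h m r a hr)); apply: h'.
Qed.

(** Equal functions agree pointwise by definition of [eqT]; changing the argument is where the
    extensionality axiom enters. *)
Lemma holds_eqT_app n s t (f g : tm (cx n) (Arr s t)) a b :
  holds (eqT f g) -> holds (eqT a b) -> holds (eqT (app f a) (app g b)).
Proof.
move=> /holds_eqT_arrow h hab.
have := h n (fun s x => x) a (@suffix_ren_id _).
rewrite !tren_id => /holds_eqT_trans; apply.
by move: hab; apply/holds_imp; apply: holds_ax; apply: T_ext.
Qed.

(** * The term model *)

Definition elt (s : ty) := {n : nat & tm (cx n) s}.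

Definition elt_eq s (x y : elt s) : Prop :=
  exists k (r : ren (cx (projT1 x)) (cx k)) (q : ren (cx (projT1 y)) (cx k)),
    [/\ suffix_ren r, suffix_ren q &
        holds (eqT (tren r (projT2 x)) (tren q (projT2 y)))].

Lemma elt_eq_sym s (x y : elt s) : elt_eq x y -> elt_eq y x.
Proof. by case=> k [r [q [hr hq /holds_eqT_sym h]]]; exists k, q, r. Qed.

Lemma holds_eqT_ren n m (r : ren (cx n) (cx m)) s (x y : tm (cx n) s) :
  suffix_ren r -> holds (eqT x y) -> holds (eqT (tren r x) (tren r y)).
Proof. by move=> hr h; rewrite -fren_eqT; apply/holds_ren. Qed.

Lemma elt_eq_trans s (x y z : elt s) : elt_eq x y -> elt_eq y z -> elt_eq x z.
Proof.
case=> k [r [q [hr hq h]]] [k' [r' [q' [hr' hq' h']]]].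
have [u hu] := cx_ren (leq_maxl k k'); have [v hv] := cx_ren (leq_maxr k k').
exists (maxn k k'), (fun s x => u s (r s x)), (fun s x => v s (q' s x)).
split; try exact: suffix_ren_comp.
rewrite -(tren_tren r u) -(tren_tren q' v); apply: holds_eqT_trans (holds_eqT_ren hu h) _.
move/(holds_eqT_ren hv): h'; rewrite !tren_tren.
by rewrite (suffix_ren_uniq (suffix_ren_comp hq hu) (suffix_ren_comp hr' hv)).
Qed.

Lemma elt_eq_level n s (a b : tm (cx n) s) :
  elt_eq (existT _ n a) (existT _ n b) <-> holds (eqT a b).
Proof.
split=> [[k [r [q [/= hr hq]]]]|h].
  by rewrite (suffix_ren_uniq hq hr) -fren_eqT => /(holds_ren _ hr).
by exists n, (fun s x => x), (fun s x => x); split; rewrite //= !tren_id.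
Qed.

Lemma elt_eq_lift n m (r : ren (cx n) (cx m)) s (a : tm (cx n) s) :
  suffix_ren r -> elt_eq (existT _ n a) (existT _ m (tren r a)).
Proof.
move=> hr; exists m, r, (fun s x => x); split=> //=.
by rewrite tren_id; apply: holds_eqT_refl.
Qed.

(** The quotient by [elt_eq], encoded by its classes so that provably equal terms become identical
    elements. *)
Definition hdom (s : ty) := {P : elt s -> Prop | exists x, P = elt_eq x}.

Definition cls n s (a : tm (cx n) s) : hdom s :=
  exist _ (elt_eq (existT _ n a)) (ex_intro _ _ erefl).

Lemma cls_eq n m s (a : tm (cx n) s) (b : tm (cx m) s) :
  cls a = cls b <-> elt_eq (existT _ n a) (existT _ m b).
Proof.
split=> [[->]|h].
  by apply/elt_eq_level; apply: holds_eqT_refl.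
apply: eq_exist; apply: funext => z; apply: propext; split.
  by apply: elt_eq_trans; apply: elt_eq_sym.
exact: elt_eq_trans.
Qed.

Lemma cls_level n s (a b : tm (cx n) s) : cls a = cls b <-> holds (eqT a b).
Proof. by rewrite cls_eq; apply: elt_eq_level. Qed.

Lemma cls_lift n m (r : ren (cx n) (cx m)) s (a : tm (cx n) s) :
  suffix_ren r -> cls (tren r a) = cls a.
Proof. by move=> hr; apply/esym/cls_eq/elt_eq_lift. Qed.

(** The bound [n] allows several elements to be represented over one common stage. *)
Lemma hdomP n s (p : hdom s) : exists m (r : ren (cx n) (cx m)) (a : tm (cx m) s),
  suffix_ren r /\ p = cls a.
Proof.
case: p => P [[k a] e].
have [r hr] := cx_ren (leq_maxl n k); have [q hq] := cx_ren (leq_maxr n k).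
exists (maxn n k), r, (tren q a); split=> //.
by rewrite cls_lift //; apply: eq_exist.
Qed.

Definition happ_rel s t (f : hdom (Arr s t)) (a : hdom s) (b : hdom t) : Prop :=
  exists n (f0 : tm (cx n) (Arr s t)) a0,
    [/\ f = cls f0, a = cls a0 & b = cls (app f0 a0)].

Lemma happ_ex s t (f : hdom (Arr s t)) (a : hdom s) : exists b, happ_rel f a b.
Proof.
have [n [_ [f0 [_ ->]]]] := hdomP 0 f.
have [m [r [a0 [hr ->]]]] := hdomP n a.
by exists (cls (app (tren r f0) a0)), m, (tren r f0), a0; rewrite cls_lift.
Qed.

Definition happ s t (f : hdom (Arr s t)) (a : hdom s) : hdom t :=
  projT1 (cid (happ_ex f a)).

(** The value in [happ] is picked from unspecified representatives; congruence of provable equality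
    makes the choice immaterial. *)
Lemma happE n s t (f : tm (cx n) (Arr s t)) a :
  happ (cls f) (cls a) = cls (app f a).
Proof.
rewrite /happ; case: (cid _) => b /= [m [f0 [a0 [ef ea ->]]]].
have [u hu] := cx_ren (leq_maxl m n); have [v hv] := cx_ren (leq_maxr m n).
rewrite -(cls_lift (app f0 a0) hu) -(cls_lift (app f a) hv) /=.
apply/cls_level; apply: holds_eqT_app; apply/cls_level.
  by rewrite !cls_lift.
by rewrite !cls_lift.
Qed.

(** The quantifier inside [eqT] at an arrow type ranges over terms of all stages reached later, and
    each of them is an element at which the two functions agree. *)
Lemma happ_ext s t (f g : hdom (Arr s t)) :
  (forall x, happ f x = happ g x) -> f = g.
Proof.
have [n [_ [f0 [_ ->]]]] := hdomP 0 f.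
have [m [r [g0 [hr ->]]]] := hdomP n g.
rewrite -(cls_lift f0 hr) => h; apply/cls_level/holds_eqT_arrow => k q a hq.
by apply/cls_level; rewrite -!happE !cls_lift // -(cls_lift f0 hr).
Qed.

Definition hlt (p q : hdom N) : Prop :=
  exists n (a b : tm (cx n) N), [/\ p = cls a, q = cls b & holds (Lt0 a b)].

Lemma hltE n (a b : tm (cx n) N) : hlt (cls a) (cls b) <-> holds (Lt0 a b).
Proof.
split=> [[m [a0 [b0 [ea eb h]]]]|h]; last by exists n, a, b.
have [u hu] := cx_ren (leq_maxl m n); have [v hv] := cx_ren (leq_maxr m n).
move/(holds_ren _ hu): h => /= h; apply/(holds_ren _ hv) => /=.
have {}ea : holds (eqT (tren v a) (tren u a0)).
  by apply/cls_level; rewrite !cls_lift.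
have {}eb : holds (eqT (tren v b) (tren u b0)).
  by apply/cls_level; rewrite !cls_lift.
move/holds_eqT_sym: ea => ea; move/holds_eqT_sym: eb => eb.
move: (tren v a) (tren v b) (tren u a0) (tren u b0) h ea eb.
move=> {}a {}b {}a0 {}b0 h ea eb.
(* The two sides are replaced one at a time by substitution of equals, since the order is a
   primitive relation. *)
suff h' : holds (Lt0 a b0).
  apply: holds_prf2 h' eb.
  have := @EqSubst T _ [:: Lt0 a b0; Eq0 b0 b] (Lt0 (twk a) v0) b0 b.
  rewrite /inst /= !tsub_vcase_twk !tsub_id; apply; apply: Hyp.
    by right; left.
  by left.
apply: holds_prf2 h ea.
have := @EqSubst T _ [:: Lt0 a0 b0; Eq0 a0 a] (Lt0 v0 (twk b0)) a0 a.
rewrite /inst /= !tsub_vcase_twk !tsub_id; apply; apply: Hyp.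
  by right; left.
by left.
Qed.

Definition hmodel : model := {|
  dom := hdom;
  ap := happ;
  ap_ext := happ_ext;
  mZero := cls (n := 0) cZero;
  mOne := cls (n := 0) cOne;
  mAdd := cls (n := 0) cAdd;
  mMul := cls (n := 0) cMul;
  mPi := fun s t => cls (n := 0) cPi;
  mSig := fun r s t => cls (n := 0) cSig;
  mRec := cls (n := 0) cRec;
  mLt := hlt |}.

(** * The truth lemma *)

Definition cls_env G n (sb : sbs G (cx n)) : env hmodel G :=
  fun s x => cls (sb s x).

Lemma ev_cls G n (sb : sbs G (cx n)) s (t : tm G s) :
  ev (cls_env sb) t = cls (tsub sb t).
Proof.
(* The constants of the model are classes from stage 0 and have to be lifted to stage [n]. *)
have [r hr] := cx_ren (leq0n n).
elim: t sb => {s} [s x|s t f hf a ha| | | | |s t|r' s t| ] sb //=;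
  last by symmetry; rewrite -(cls_lift cRec hr).
- by rewrite hf ha happE.
- by rewrite -(cls_lift cZero hr).
- by rewrite -(cls_lift cOne hr).
- by rewrite -(cls_lift cAdd hr).
- by rewrite -(cls_lift cMul hr).
- by rewrite -(cls_lift cPi hr).
- by rewrite -(cls_lift cSig hr).
Qed.

Lemma cls_env_lift G n m (r : ren (cx n) (cx m)) (sb : sbs G (cx n)) s a :
  suffix_ren r ->
  econs (M := hmodel) (cls a) (cls_env sb) =
  cls_env (vcase (t := s) a (fun u x => tren r (sb u x))).
Proof.
by move=> hr; apply: fun_var_cons_ext => //= u x; rewrite /cls_env /= cls_lift.
Qed.

Lemma truth G (A : fm G) n (sb : sbs G (cx n)) :
  sat (cls_env sb) A <-> holds (fsub sb A).
Proof.
elim: A n sb => {G} [G t u|G t u|G|G A hA B hB|G A hA B hB|G A hA B hB|G s A hA|G s A hA]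
  n sb /=.
- by rewrite !ev_cls; apply: cls_level.
- by rewrite !ev_cls; apply: hltE.
- by split=> // /holds_cons.
- by rewrite holds_imp hA hB.
- by rewrite holds_and hA hB.
- by rewrite holds_or hA hB.
- rewrite holds_all; split=> [h m r t hr|h a].
    by rewrite inst_fren_ups -hA -(cls_env_lift _ _ hr).
  have [m [r [t [hr ->]]]] := hdomP n a.
  by rewrite (cls_env_lift _ _ hr) hA -inst_fren_ups; apply: h.
- rewrite holds_ex; split=> [[a]|[m [r [t [hr]]]]].
    have [m [r [t [hr ->]]]] := hdomP n a.
    rewrite (cls_env_lift _ _ hr) hA -inst_fren_ups => h.
    by exists m, r, t.
  rewrite inst_fren_ups -hA -(cls_env_lift _ _ hr) => h.
  by exists (cls t).
Qed.

Lemma var_nil s : var [::] s -> False.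
Proof. by move=> x; inversion x. Qed.

(** A context is finite, so all its values can be represented over one stage. *)
Lemma env_level G (e : env hmodel G) : exists n (sb : sbs G (cx n)), e = cls_env sb.
Proof.
elim: G e => [|s G hG] e.
  exists 0, (fun s x => False_rect _ (var_nil x)).
  by apply: fun_var_ext => s x; case: (var_nil x).
have [n [sb he]] := hG (fun s x => e s (vs x)).
have [m [r [t [hr et]]]] := hdomP n (e s vz).
exists m, (vcase t (fun u x => tren r (sb u x))).
rewrite -cls_env_lift // -he -et.
exact: fun_var_cons_ext.
Qed.

Lemma henkin : exists2 M, models T M & exists e : env M [::], ~ sat e C0.
Proof.
exists hmodel.
  move=> G A tA e; have [n [sb ->]] := env_level e.
  by apply/truth; apply: holds_ax; apply: T_sub.
exists (cls_env (n := 0) (fun s x => tvar x)); rewrite truth fsub_id => h.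
apply: (@holds_cons 0); apply: holds_prf2 h (_ : holds (n := 0) (Imp C0 Bot)).
  by apply: (ImpE (A := C0)); apply: Hyp; [right; left|left].
exists 0, (fun s x => x); split=> //; rewrite fren_id.
by apply: Hyp; left.
Qed.

End Henkin.

Theorem completeness (T : theory) (A : fm [::]) :
  fsub_closed T ->
  (forall G s t (x y : tm G s) (f : tm G (Arr s t)),
    T G (Imp (eqT x y) (eqT (app f x) (app f y)))) ->
  (forall M, models T M -> forall e : env M [::], sat e A) -> proves T A.
Proof.
move=> T_sub T_ext h; apply: contrapT => np.
by have [M /h hM [e]] := henkin T_sub T_ext np.
Qed.

(** * The ordered field of fractions of an ordered semiring *)

Import Order.TTheory GRing.Theory Num.Theory.
Local Open Scope ring_scope.

(** The last two fields make this the nonnegative part of a discretely ordered ring. *)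
Record osemiring := OSemiring {
  ocar : Type;
  ozero : ocar;
  oone : ocar;
  oadd : ocar -> ocar -> ocar;
  omul : ocar -> ocar -> ocar;
  olt : ocar -> ocar -> Prop;
  oaddA : associative oadd;
  oaddC : commutative oadd;
  oadd0 : left_id ozero oadd;
  omulA : associative omul;
  omulC : commutative omul;
  omul1 : left_id oone omul;
  omul0 : left_zero ozero omul;
  omulDl : left_distributive omul oadd;
  olt01 : olt ozero oone;
  olt_irr : forall x, ~ olt x x;
  olt_trans : forall x y z, olt x y -> olt y z -> olt x z;
  olt_total : forall x y, olt x y \/ x = y \/ olt y x;
  olt_add : forall x y z, olt x y -> olt (oadd x z) (oadd y z);
  olt_mul : forall x y z, olt ozero z -> olt x y -> olt (omul x z) (omul y z);
  osub : forall x y, olt x y -> exists d, y = oadd (oadd x d) oone;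
  oge0 : forall x, x = ozero \/ olt ozero x }.

Section Carrier.
Variable R : osemiring.

(** A separate name to which the algebraic structures, and with them [ring], can be attached. *)
Definition ocarrier : Type := ocar R.

HB.instance Definition _ := gen_eqMixin ocarrier.
HB.instance Definition _ := gen_choiceMixin ocarrier.
HB.instance Definition _ := GRing.isNmodule.Build ocarrier
  (@oaddA R) (@oaddC R) (@oadd0 R).

Fact oone_neq0 : oone R != 0 :> ocarrier.
Proof.
by apply/eqP => e; have := olt01 R; rewrite (e : oone R = ozero R) => /olt_irr.
Qed.

HB.instance Definition _ := GRing.Nmodule_isComNzSemiRing.Build ocarrier
  (@omulA R) (@omulC R) (@omul1 R) (@omulDl R) (@omul0 R) oone_neq0.

End Carrier.

Section Fractions.
Variable R : osemiring.
Local Notation S := (ocarrier R).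
Implicit Types a b c d : S.

Definition slt a b : Prop := @olt R a b.

Lemma slt_irr a : ~ slt a a. Proof. exact: olt_irr. Qed.
Lemma slt_trans a b c : slt a b -> slt b c -> slt a c. Proof. exact: olt_trans. Qed.
Lemma slt_total a b : slt a b \/ a = b \/ slt b a. Proof. exact: olt_total. Qed.
Lemma slt_add a b c : slt a b -> slt (a + c) (b + c). Proof. exact: olt_add. Qed.
Lemma slt_mul a b c : slt 0 c -> slt a b -> slt (a * c) (b * c).
Proof. exact: olt_mul. Qed.
Lemma slt01 : slt 0 1. Proof. exact: olt01. Qed.
Lemma slt_sub a b : slt a b -> exists d, b = a + d + 1. Proof. exact: osub. Qed.
Lemma sge0 a : a = 0 \/ slt 0 a. Proof. exact: oge0. Qed.

Lemma o_addI a b c : a + c = b + c -> a = b.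
Proof.
by case: (slt_total a b) => [h|[//|h]] e; have := slt_add c h; rewrite e => /slt_irr.
Qed.

Lemma o_gt0 c : slt 0 (c + 1).
Proof.
case: (sge0 c) => [->|h]; first by rewrite add0r; apply: slt01.
apply: (slt_trans (b := 0 + 1)); last exact: slt_add.
by rewrite add0r; apply: slt01.
Qed.

Lemma o_mulI a b c : a * (c + 1) = b * (c + 1) -> a = b.
Proof.
case: (slt_total a b) => [h|[//|h]] e; have := slt_mul (o_gt0 c) h;
  by rewrite e => /slt_irr.
Qed.

Lemma o_cmp a b : a = b \/ (exists d, a = b + d + 1) \/ (exists d, b = a + d + 1).
Proof.
case: (slt_total a b) => [/slt_sub|[|/slt_sub]]; first by right; right.
  by left.
by right; left.
Qed.

Lemma o_add_eq0 a b : a + b = 0 -> a = 0.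
Proof.
case: (sge0 a) => [//|h]; case: (sge0 b) => [->|h']; first by rewrite addr0.
rewrite addrC => e; have := slt_trans h (_ : slt a 0).
by case/(_ _)/slt_irr; rewrite -e -{1}[a]add0r; apply: slt_add.
Qed.

(** [(a, b, c)] stands for (a - b) / (c + 1). *)
Definition ofrac_rep : Type := (S * S * S)%type.
Implicit Types x y z : ofrac_rep.

Definition feq x y : Prop :=
  x.1.1 * (y.2 + 1) + y.1.2 * (x.2 + 1) = y.1.1 * (x.2 + 1) + x.1.2 * (y.2 + 1).

Lemma feq_refl x : feq x x. Proof. by []. Qed.

Lemma feq_sym x y : feq x y -> feq y x. Proof. by rewrite /feq => ->. Qed.

Lemma feq_trans x y z : feq x y -> feq y z -> feq x z.
Proof.
case: x y z => [[a b] c] [[a' b'] c'] [[a'' b''] c'']; rewrite /feq /= => e1 e2.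
(* Without subtraction, both sides are multiplied by the middle denominator and padded with terms of
   the middle fraction, until the left sides of [e1] and [e2] appear. *)
apply: (o_mulI (c := c')).
apply: (o_addI (c := b' * (c + 1) * (c'' + 1) + a' * (c + 1) * (c'' + 1))).
transitivity ((a * (c' + 1) + b' * (c + 1)) * (c'' + 1) +
              (a' * (c'' + 1) + b'' * (c' + 1)) * (c + 1)); first by ring.
by rewrite e1 e2; ring.
Qed.

Definition ofrac : Type := {P : ofrac_rep -> Prop | exists x, P = feq x}.

Definition fcls x : ofrac := exist _ (feq x) (ex_intro _ _ erefl).

Lemma fcls_eq x y : feq x y -> fcls x = fcls y.
Proof.
move=> h; apply: eq_exist; apply: funext => z; apply: propext; split.
  by apply: feq_trans; apply: feq_sym.
exact: feq_trans.
Qed.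

Lemma fcls_inj x y : fcls x = fcls y -> feq x y.
Proof. by case=> ->; apply: feq_refl. Qed.

Lemma fclsP (p : ofrac) : exists x, p = fcls x.
Proof. by case: p => P [x e]; exists x; apply: eq_exist. Qed.

Definition frepr (p : ofrac) : ofrac_rep := projT1 (cid (fclsP p)).

Lemma freprK p : fcls (frepr p) = p.
Proof. by rewrite /frepr; case: (cid _). Qed.

Lemma frepr_feq x : feq (frepr (fcls x)) x.
Proof. by apply: fcls_inj; rewrite freprK. Qed.

(** Denominators are stored minus one, and (c + 1)(d + 1) = (cd + c + d) + 1. *)
Definition fadd_rep x y : ofrac_rep :=
  (x.1.1 * (y.2 + 1) + y.1.1 * (x.2 + 1), x.1.2 * (y.2 + 1) + y.1.2 * (x.2 + 1),
   x.2 * y.2 + x.2 + y.2).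
Definition fmul_rep x y : ofrac_rep :=
  (x.1.1 * y.1.1 + x.1.2 * y.1.2, x.1.1 * y.1.2 + x.1.2 * y.1.1,
   x.2 * y.2 + x.2 + y.2).
Definition fopp_rep x : ofrac_rep := (x.1.2, x.1.1, x.2).

Lemma fadd_repE x x' y y' : feq x x' -> feq y y' -> feq (fadd_rep x y) (fadd_rep x' y').
Proof.
case: x x' y y' => [[a b] c] [[a' b'] c'] [[d e] f] [[d' e'] f'].
rewrite /feq /= => h1 h2.
transitivity ((a * (c' + 1) + b' * (c + 1)) * (f + 1) * (f' + 1) +
              (d * (f' + 1) + e' * (f + 1)) * (c + 1) * (c' + 1)); first by ring.
by rewrite h1 h2; ring.
Qed.

Lemma fmul_repC x y : fmul_rep x y = fmul_rep y x.
Proof. by congr (_, _, _); ring. Qed.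

Lemma fmul_repEl x x' y : feq x x' -> feq (fmul_rep x y) (fmul_rep x' y).
Proof.
case: x x' y => [[a b] c] [[a' b'] c'] [[d e] f]; rewrite /feq /= => h.
transitivity ((a * (c' + 1) + b' * (c + 1)) * d * (f + 1) +
              (a' * (c + 1) + b * (c' + 1)) * e * (f + 1)); first by ring.
transitivity ((a' * (c + 1) + b * (c' + 1)) * d * (f + 1) +
              (a * (c' + 1) + b' * (c + 1)) * e * (f + 1)); last by ring.
by rewrite h.
Qed.

Lemma fmul_repE x x' y y' : feq x x' -> feq y y' -> feq (fmul_rep x y) (fmul_rep x' y').
Proof.
move=> h h'; apply: (feq_trans (fmul_repEl y h)).
by rewrite (fmul_repC x' y) (fmul_repC x' y'); apply: fmul_repEl.
Qed.

Lemma fopp_repE x y : feq x y -> feq (fopp_rep x) (fopp_rep y).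
Proof.
case: x y => [[a b] c] [[a' b'] c']; rewrite /feq /= => h.
by rewrite [LHS]addrC -h addrC.
Qed.

(** * Field operations on the quotient *)

Definition fadd (p q : ofrac) : ofrac := fcls (fadd_rep (frepr p) (frepr q)).
Definition fmul (p q : ofrac) : ofrac := fcls (fmul_rep (frepr p) (frepr q)).
Definition fopp (p : ofrac) : ofrac := fcls (fopp_rep (frepr p)).

Lemma faddE x y : fadd (fcls x) (fcls y) = fcls (fadd_rep x y).
Proof. by apply: fcls_eq; apply: fadd_repE; apply: frepr_feq. Qed.
Lemma fmulE x y : fmul (fcls x) (fcls y) = fcls (fmul_rep x y).
Proof. by apply: fcls_eq; apply: fmul_repE; apply: frepr_feq. Qed.
Lemma foppE x : fopp (fcls x) = fcls (fopp_rep x).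
Proof.
by apply: fcls_eq; apply: fopp_repE; apply: frepr_feq.
Qed.

Definition fzero : ofrac := fcls (0, 0, 0).
Definition fone : ofrac := fcls (1, 0, 0).

Lemma faddA : associative fadd.
Proof.
move=> p q r; have [[[a b] c] ->] := fclsP p; have [[[d e] f] ->] := fclsP q.
have [[[g h] i] ->] := fclsP r; rewrite !faddE; congr fcls.
by rewrite /fadd_rep /=; congr (_, _, _); ring.
Qed.

Lemma faddC : commutative fadd.
Proof.
move=> p q; have [[[a b] c] ->] := fclsP p; have [[[d e] f] ->] := fclsP q.
by rewrite !faddE; congr fcls; rewrite /fadd_rep /=; congr (_, _, _); ring.
Qed.

Lemma fadd0 : left_id fzero fadd.
Proof.
move=> p; have [[[a b] c] ->] := fclsP p.
by rewrite !faddE; congr fcls; rewrite /fadd_rep /=; congr (_, _, _); ring.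
Qed.

Lemma faddN : left_inverse fzero fopp fadd.
Proof.
move=> p; have [[[a b] c] ->] := fclsP p.
by rewrite foppE faddE; apply: fcls_eq; rewrite /feq /=; ring.
Qed.

Lemma fmulA : associative fmul.
Proof.
move=> p q r; have [[[a b] c] ->] := fclsP p; have [[[d e] f] ->] := fclsP q.
have [[[g h] i] ->] := fclsP r; rewrite !fmulE; congr fcls.
by rewrite /fmul_rep /=; congr (_, _, _); ring.
Qed.

Lemma fmulC : commutative fmul.
Proof.
move=> p q; have [[[a b] c] ->] := fclsP p; have [[[d e] f] ->] := fclsP q.
by rewrite !fmulE; congr fcls; rewrite /fmul_rep /=; congr (_, _, _); ring.
Qed.

Lemma fmul1 : left_id fone fmul.
Proof.
move=> p; have [[[a b] c] ->] := fclsP p.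
by rewrite !fmulE; congr fcls; rewrite /fmul_rep /=; congr (_, _, _); ring.
Qed.

Lemma fmulDl : left_distributive fmul fadd.
Proof.
move=> p q r; have [[[a b] c] ->] := fclsP p; have [[[d e] f] ->] := fclsP q.
have [[[g h] i] ->] := fclsP r; rewrite !(faddE, fmulE).
by apply: fcls_eq; rewrite /feq /=; ring.
Qed.

HB.instance Definition _ := gen_eqMixin ofrac.
HB.instance Definition _ := gen_choiceMixin ofrac.
HB.instance Definition _ := GRing.isZmodule.Build ofrac faddA faddC fadd0 faddN.

Fact fone_neq0 : fone != 0 :> ofrac.
Proof.
apply/eqP => /fcls_inj; rewrite /feq /= !(add0r, mulr1, mul0r, addr0).
by move=> e; have := oone_neq0 R; rewrite -[oone R]/(1 : S) e eqxx.
Qed.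

HB.instance Definition _ := GRing.Zmodule_isComNzRing.Build ofrac
  fmulA fmulC fmul1 fmulDl fone_neq0.

Definition fnonneg (p : ofrac) : Prop := exists a c, p = fcls (a, 0, c).

Lemma fcls_diag a c : fcls (a, a, c) = 0.
Proof. by apply: fcls_eq; rewrite /feq /=; ring. Qed.

Lemma fcls_sign (p : ofrac) : p = 0 \/
  (exists d c, p = fcls (d + 1, 0, c)) \/ (exists d c, p = fcls (0, d + 1, c)).
Proof.
have [[[a b] c] ->] := fclsP p.
case: (o_cmp a b) => [->|[[d ->]|[d ->]]].
- by left; apply: fcls_diag.
- by right; left; exists d, c; apply: fcls_eq; rewrite /feq /=; ring.
- by right; right; exists d, c; apply: fcls_eq; rewrite /feq /=; ring.
Qed.

(** Up to sign a nonzero numerator is a successor, so numerator and denominator can trade places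
    within the encoding. *)
Lemma finv_ex (p : ofrac) : exists q, (p != 0 -> q * p = 1) /\ (p = 0 -> q = 0).
Proof.
have [->|p0] := eqVneq p 0; first by exists 0.
suff [q hq] : exists q, q * p = 1 by exists q; split=> // p0'; rewrite p0' eqxx in p0.
case: (fcls_sign p) p0 => [-> /eqP //|[[d [c ->]]|[d [c ->]]]] _.
- exists (fcls (c + 1, 0, d)); rewrite -[_ * _]/(fmul _ _) fmulE.
  by apply: fcls_eq; rewrite /feq /=; ring.
- exists (fcls (0, c + 1, d)); rewrite -[_ * _]/(fmul _ _) fmulE.
  by apply: fcls_eq; rewrite /feq /=; ring.
Qed.

Definition finv (p : ofrac) : ofrac := projT1 (cid (finv_ex p)).

Fact fmulVf (p : ofrac) : p != 0 -> finv p * p = 1.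
Proof. by rewrite /finv; case: (cid _) => q []. Qed.

Fact finv0 : finv 0 = 0.
Proof. by rewrite /finv; case: (cid _) => q h /=; apply: (proj2 h). Qed.

HB.instance Definition _ := GRing.ComNzRing_isField.Build ofrac fmulVf finv0.

Lemma fnonneg_add (p q : ofrac) : fnonneg p -> fnonneg q -> fnonneg (p + q).
Proof.
case=> a [c ->] [a' [c' ->]]; rewrite -[_ + _]/(fadd _ _) faddE.
exists (a * (c' + 1) + a' * (c + 1)), (c * c' + c + c'); congr fcls.
by rewrite /fadd_rep /=; congr (_, _, _); ring.
Qed.

Lemma fnonneg_mul (p q : ofrac) : fnonneg p -> fnonneg q -> fnonneg (p * q).
Proof.
case=> a [c ->] [a' [c' ->]]; rewrite -[_ * _]/(fmul _ _) fmulE.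
exists (a * a'), (c * c' + c + c'); congr fcls.
by rewrite /fmul_rep /=; congr (_, _, _); ring.
Qed.

(** Comparing the two representatives gives a sum of semiring elements equal to 0, and summands of 0
    vanish. *)
Lemma fnonneg_anti (p : ofrac) : fnonneg p -> fnonneg (- p) -> p = 0.
Proof.
case=> a [c ->] [a' [c']]; rewrite -[- _]/(fopp _) foppE => /fcls_inj.
rewrite /feq /= !mul0r add0r addrC => /esym /o_add_eq0.
by rewrite -[RHS](mul0r (c' + 1)) => /o_mulI ->; apply: fcls_diag.
Qed.

Lemma fnonneg_total (p : ofrac) : fnonneg p \/ fnonneg (- p).
Proof.
case: (fcls_sign p) => [->|[[d [c ->]]|[d [c ->]]]].
- by left; exists 0, 0.
- by left; exists (d + 1), c.
- by right; exists (d + 1), c; rewrite -[- _]/(fopp _) foppE.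
Qed.

(** * The order on the fractions *)

Definition fle (p q : ofrac) : bool := `[< fnonneg (q - p) >].
Definition flt (p q : ofrac) : bool := (q != p) && fle p q.
Definition fnorm (p : ofrac) : ofrac := if fle 0 p then p else - p.

Fact fle0_add (p q : ofrac) : fle 0 p -> fle 0 q -> fle 0 (p + q).
Proof.
rewrite /fle !subr0 => /asboolP hp /asboolP hq.
by apply/asboolP; apply: fnonneg_add.
Qed.

Fact fle0_mul (p q : ofrac) : fle 0 p -> fle 0 q -> fle 0 (p * q).
Proof.
rewrite /fle !subr0 => /asboolP hp /asboolP hq.
by apply/asboolP; apply: fnonneg_mul.
Qed.

Fact fle0_anti (p : ofrac) : fle 0 p -> fle p 0 -> p = 0.
Proof. by rewrite /fle subr0 sub0r => /asboolP hp /asboolP; apply: fnonneg_anti. Qed.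

Fact fsub_ge0 (p q : ofrac) : fle 0 (q - p) = fle p q.
Proof. by rewrite /fle subr0. Qed.

Fact fle0_total (p : ofrac) : fle 0 p || fle p 0.
Proof.
rewrite /fle subr0 sub0r; apply/orP.
by case: (fnonneg_total p) => h; [left|right]; apply/asboolP.
Qed.

Fact fnormN (p : ofrac) : fnorm (- p) = fnorm p.
Proof.
rewrite /fnorm opprK; case: ifPn => h; case: ifPn => h' //.
- by rewrite (fle0_anti h') ?oppr0 // -fsub_ge0 sub0r.
- have /orP [e|e] := fle0_total p; first by rewrite e in h'.
  by move: h; rewrite -sub0r fsub_ge0 e.
Qed.

Fact fge0_norm (p : ofrac) : fle 0 p -> fnorm p = p.
Proof. by rewrite /fnorm => ->. Qed.

HB.instance Definition _ := Num.IntegralDomain_isLeReal.Build ofrac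
  fle0_add fle0_mul fle0_anti fsub_ge0 fle0_total fnormN fge0_norm
  (fun p q => erefl : flt p q = (q != p) && fle p q).

(** * Embedding of the semiring *)

Definition fnat (a : S) : ofrac := fcls (a, 0, 0).

Lemma fnat0 : fnat 0 = 0. Proof. by []. Qed.
Lemma fnat1 : fnat 1 = 1. Proof. by []. Qed.

Lemma fnatD a b : fnat (a + b) = fnat a + fnat b.
Proof.
rewrite -[RHS]/(fadd _ _) faddE; congr fcls; rewrite /fadd_rep /=.
by congr (_, _, _); ring.
Qed.

Lemma fnatM a b : fnat (a * b) = fnat a * fnat b.
Proof.
rewrite -[RHS]/(fmul _ _) fmulE; congr fcls; rewrite /fmul_rep /=.
by congr (_, _, _); ring.
Qed.

Lemma fnat_inj : injective fnat.
Proof.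
move=> a b /fcls_inj; rewrite /feq /= !mul0r !addr0.
exact: o_mulI.
Qed.

Lemma fnat_ge0 a : 0 <= fnat a.
Proof. by apply/asboolP; rewrite subr0; exists a, 0. Qed.

Lemma fnat_lt a b : fnat a < fnat b <-> slt a b.
Proof.
suff h c d : slt c d -> fnat c < fnat d.
  split; last exact: h.
  move=> hab; case: (slt_total a b) => [//|[e|/h hba]].
    by move: hab; rewrite e ltxx.
  by have := lt_trans hab hba; rewrite ltxx.
move=> /slt_sub [e ->]; rewrite !fnatD fnat1.
by have := fnat_ge0 e; lra.
Qed.

Lemma fcls_val a b c : fcls (a, b, c) = (fnat a - fnat b) / (fnat c + 1).
Proof.
have c0 : fnat c + 1 != 0.
  by have h := fnat_ge0 c; apply: lt0r_neq0; lra.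
apply: (mulIf c0); rewrite divfK // -fnat1 -fnatD.
apply: (addIr (fnat b)); rewrite subrK.
rewrite -[LHS]/(fadd (fmul _ _) _) fmulE faddE; apply: fcls_eq.
by rewrite /feq /=; ring.
Qed.

(** The field is Archimedean relative to the numbers of the semiring: (d + 1)/(c + 1) is at least
    1/(c + 1). *)
Lemma fnat_archimedean (x : ofrac) : 0 < x -> exists a, (fnat a + 1)^-1 <= x.
Proof.
case: (fcls_sign x) => [->|[[d [c ->]]|[d [c ->]]]]; rewrite ?ltxx //.
  move=> _; exists c; rewrite fcls_val fnat0 subr0 fnatD fnat1.
  have c0 : 0 < fnat c + 1 by have := fnat_ge0 c; lra.
  rewrite -[leLHS]mul1r ler_pM2r ?invr_gt0 //.
  by have := fnat_ge0 d; lra.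
rewrite fcls_val fnat0 sub0r fnatD fnat1 => h; exfalso; move: h.
apply/negP; rewrite -leNgt mulNr oppr_le0 mulr_ge0 ?invr_ge0 //.
  by have := fnat_ge0 d; lra.
by have := fnat_ge0 c; lra.
Qed.

End Fractions.

(** * Arithmetic in a model *)

Section Arithmetic.
Variable M : model.
Hypothesis hM : models RCA0w M.

Definition enil : env M [::] := fun s x => False_rect _ (var_nil x).

Local Notation e1 x := (econs x enil).
Local Notation e2 x y := (econs y (econs x enil)).
Local Notation e3 x y z := (econs z (econs y (econs x enil))).

Local Notation mlt := (@mLt M).

Definition madd (x y : M N) : M N := ap (ap (mAdd M) x) y.
Definition mmul (x y : M N) : M N := ap (ap (mMul M) x) y.
Local Notation m0 := (mZero M).
Local Notation m1 := (mOne M).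

Lemma m_addA : associative madd.
Proof. by move=> x y z; have /= := hM (Defs.addA v2 v1 v0) (e3 x y z). Qed.
Lemma m_addC : commutative madd.
Proof. by move=> x y; have := hM (Defs.addC v1 v0) (e2 x y). Qed.
Lemma m_add0 : left_id m0 madd.
Proof. by move=> x; rewrite m_addC; have := hM (Defs.add0 v0) (e1 x). Qed.
Lemma m_mulA : associative mmul.
Proof. by move=> x y z; have /= := hM (Defs.mulA v2 v1 v0) (e3 x y z). Qed.
Lemma m_mulC : commutative mmul.
Proof. by move=> x y; have := hM (Defs.mulC v1 v0) (e2 x y). Qed.
Lemma m_mul1 : left_id m1 mmul.
Proof. by move=> x; rewrite m_mulC; have := hM (Defs.mul1 v0) (e1 x). Qed.
Lemma m_mul0 : left_zero m0 mmul.
Proof. by move=> x; rewrite m_mulC; have := hM (Defs.mul0 v0) (e1 x). Qed.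
Lemma m_mulDl : left_distributive mmul madd.
Proof.
by move=> x y z; rewrite !(m_mulC _ z); have := hM (Defs.mulDr v2 v1 v0) (e3 z x y).
Qed.
Lemma m_lt01 : mlt m0 m1.
Proof. exact: (hM (lt01 [::]) enil). Qed.
Lemma m_ltirr x : ~ mlt x x.
Proof. exact: (hM (ltirr v0) (e1 x)). Qed.
Lemma m_lttrans x y z : mlt x y -> mlt y z -> mlt x z.
Proof. exact: (hM (lttrans v2 v1 v0) (e3 x y z)). Qed.
Lemma m_lttotal x y : mlt x y \/ x = y \/ mlt y x.
Proof. exact: (hM (lttotal v1 v0) (e2 x y)). Qed.
Lemma m_ltadd x y z : mlt x y -> mlt (madd x z) (madd y z).
Proof. exact: (hM (ltadd v2 v1 v0) (e3 x y z)). Qed.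
Lemma m_ltmul x y z : mlt m0 z -> mlt x y -> mlt (mmul x z) (mmul y z).
Proof. exact: (hM (ltmul v2 v1 v0) (e3 x y z)). Qed.

Lemma m_PiE s t (x : M s) (y : M t) : ap (ap (mPi M s t) x) y = x.
Proof. by have := hM (PiE v1 v0) (e2 x y); rewrite sat_eqT. Qed.
Lemma m_SigE r s t (x : M (Arr r (Arr s t))) (y : M (Arr r s)) (z : M r) :
  ap (ap (ap (mSig M r s t) x) y) z = ap (ap x z) (ap y z).
Proof. by have := hM (SigE v2 v1 v0) (e3 x y z); rewrite sat_eqT. Qed.

Definition mrec (f : M (Arr N (Arr N N))) (a n : M N) : M N :=
  ap (ap (ap (mRec M) f) a) n.

Lemma m_rec0 f a : mrec f a m0 = a.
Proof. exact: (hM (RecO v1 v0) (e2 f a)). Qed.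
Lemma m_recS f a n : mrec f a (madd n m1) = ap (ap f n) (mrec f a n).
Proof. exact: (hM (RecS v2 v1 v0) (e3 f a n)). Qed.

Lemma ev_lam G (e : env M G) s t (a : tm (s :: G) t) (x : M s) :
  ap (ev e (lam a)) x = ev (econs x e) a.
Proof.
elim: a => {t} [t y|t u f hf b hb| | | | |t u|r t u| ] /=; rewrite ?m_PiE //.
  pose P t (y : var (s :: G) t) :=
    ap (ev e (lam (tvar y))) x = econs x e y.
  move: t y; apply: (var_case (P := P)) => [|t y]; rewrite /P /=.
    by rewrite m_SigE !m_PiE.
  by rewrite m_PiE.
by rewrite m_SigE hf hb.
Qed.

Lemma qf_ind G (A : fm (N :: G)) (e : env M G) : qfree A ->
  sat (econs m0 e) A ->
  (forall n, sat (econs n e) A -> sat (econs (madd n m1) e) A) ->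
  forall n, sat (econs n e) A.
Proof.
move=> qA h0 hS; have /= := hM (QFInd qA) e; apply; first by rewrite sat_inst.
by move=> n hn; rewrite sat_inst sat_fwk1; apply: hS.
Qed.

Lemma m_ge0 x : x = m0 \/ mlt m0 x.
Proof.
apply: (@qf_ind [::] (Or (Eq0 v0 cZero) (Lt0 cZero v0)) enil) => //=; first by left.
move=> n [->|h]; right; first by rewrite m_add0; apply: m_lt01.
apply: (m_lttrans m_lt01); rewrite -{1}(m_add0 m1).
exact: m_ltadd.
Qed.

(** * Predecessor and truncated subtraction *)

Definition mpred (n : M N) : M N := ev (e1 n) (tpred v0).
Definition mminus (a b : M N) : M N := ev (e2 a b) (tminus v1 v0).

(** [tpred t] is a substitution instance of [tpred v0], so its value depends on that of [t]
    alone. *)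
Lemma ev_pred G (e : env M G) t : ev e (tpred t) = mpred (ev e t).
Proof.
rewrite -[tpred t]/(tsub (vcase t (fun s x => False_rect _ (var_nil x))) (tpred v0)).
rewrite ev_tsub /mpred; congr (ev _ (tpred v0)).
by apply: fun_var_cons_ext => // s x; case: (var_nil x).
Qed.

Lemma ev_minus G (e : env M G) t u : ev e (tminus t u) = mminus (ev e t) (ev e u).
Proof.
rewrite -[tminus t u]/(tsub (vcase u (vcase t
  (fun s x => False_rect _ (var_nil x)))) (tminus v1 v0)).
rewrite ev_tsub /mminus; congr (ev _ (tminus v1 v0)).
apply: fun_var_cons_eq => //; apply: fun_var_cons_ext => // s x.
by case: (var_nil x).
Qed.

Lemma m_pred0 : mpred m0 = m0.
Proof. exact: m_rec0. Qed.

Lemma m_predS n : mpred (madd n m1) = n.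
Proof.
apply: etrans (m_recS (ev (e1 (madd n m1)) (lam (lam v1))) _ _) _.
by rewrite !ev_lam.
Qed.

Lemma m_predP n : n = m0 \/ n = madd (mpred n) m1.
Proof.
have h := @qf_ind [::] (Or (Eq0 v0 cZero)
  (Eq0 v0 (app (app cAdd (tpred v0)) cOne))) enil.
apply: (h _ _ _ n) => //; first by left.
move=> k _; right; change (madd k m1 = madd (mpred (madd k m1)) m1).
by rewrite m_predS.
Qed.

Lemma m_minus0 a : mminus a m0 = a.
Proof. exact: m_rec0. Qed.

Lemma m_minusS a b : mminus a (madd b m1) = mpred (mminus a b).
Proof.
apply: etrans (m_recS (ev (e2 a (madd b m1)) (lam (lam (tpred v0)))) _ _) _.
by rewrite !ev_lam ev_pred.
Qed.

Lemma m_ltS n : mlt n (madd n m1).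
Proof. by rewrite -{1}(m_add0 n) [madd n m1]m_addC; apply: m_ltadd; apply: m_lt01. Qed.

(** The whole disjunction is quantifier-free, so it can be proved by induction on [b]; once a < b
    the difference stays 0. *)
Lemma m_minusP a b : madd b (mminus a b) = a \/ (mminus a b = m0 /\ mlt a b).
Proof.
have h := @qf_ind [:: N] (Or (Eq0 (app (app cAdd v0) (tminus v1 v0)) v1)
  (And (Eq0 (tminus v1 v0) cZero) (Lt0 v1 v0))) (e1 a).
apply: (h _ _ _ b) => {h b} //.
  by left; change (madd m0 (mminus a m0) = a); rewrite m_add0 m_minus0.
move=> n h; have {h} : madd n (mminus a n) = a \/ (mminus a n = m0 /\ mlt a n) by [].
suff : madd n (mminus a n) = a \/ (mminus a n = m0 /\ mlt a n) ->
  madd (madd n m1) (mminus a (madd n m1)) = a \/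
  (mminus a (madd n m1) = m0 /\ mlt a (madd n m1)) by [].
rewrite m_minusS => -[e|[e lt_an]]; last first.
  by right; rewrite e m_pred0; split=> //; apply: m_lttrans lt_an (m_ltS n).
case: (m_predP (mminus a n)) => e'.
  (* The difference was already 0, hence a = n, and truncation sets in at n + 1. *)
  move: e; rewrite e' m_pred0 m_addC m_add0 => <-; right; split=> //.
  exact: m_ltS.
by left; rewrite -m_addA [madd m1 _]m_addC -e'.
Qed.

Lemma m_sub x y : mlt x y -> exists d, y = madd (madd x d) m1.
Proof.
move=> lt_xy; exists (mpred (mminus y x)).
case: (m_minusP y x) => [e|[_ lt_yx]]; last first.
  by case: (m_ltirr (m_lttrans lt_xy lt_yx)).
case: (m_predP (mminus y x)) => [e0|e']; last by rewrite -m_addA -e' e.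
by move: e lt_xy; rewrite e0 m_addC m_add0 => -> /m_ltirr.
Qed.

(** * The ordered field of the model *)

Definition msemiring : osemiring := @OSemiring (M N) m0 m1 madd mmul mlt
  m_addA m_addC m_add0 m_mulA m_mulC m_mul1 m_mul0 m_mulDl m_lt01 m_ltirr
  m_lttrans m_lttotal m_ltadd m_ltmul m_sub m_ge0.

Definition K : realFieldType := ofrac msemiring.
Definition io (n : M N) : K := @fnat msemiring n.

Lemma io0 : io m0 = 0. Proof. exact: fnat0. Qed.
Lemma io1 : io m1 = 1. Proof. exact: fnat1. Qed.
Lemma ioD a b : io (madd a b) = io a + io b. Proof. exact: fnatD. Qed.
Lemma ioM a b : io (mmul a b) = io a * io b. Proof. exact: fnatM. Qed.
Lemma io_ge0 a : 0 <= io a. Proof. exact: fnat_ge0. Qed.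
Lemma io_inj : injective io. Proof. exact: fnat_inj. Qed.
Lemma io_lt a b : mlt a b <-> io a < io b.
Proof. exact: iff_sym (@fnat_lt msemiring a b). Qed.

(** Discreteness inside [K], where linear arithmetic alone knows nothing of integrality. *)
Lemma io_ltS a b : io a < io b -> io a + 1 <= io b.
Proof.
move=> /io_lt /m_sub [d ->]; rewrite !ioD io1.
by have := io_ge0 d; lra.
Qed.

Lemma io_arch (x : K) : 0 < x -> exists a, (io a + 1)^-1 <= x.
Proof. exact: fnat_archimedean. Qed.

Lemma io_pred n : n <> m0 -> io (mpred n) = io n - 1.
Proof. by case: (m_predP n) => // e _; rewrite {2}e ioD io1 addrK. Qed.

Lemma io_minus a b : io (mminus a b) = if io b <= io a then io a - io b else 0.
Proof.
case: (m_minusP a b) => [e|[-> /io_lt h]]; last by rewrite leNgt h io0.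
by rewrite -{2 3}e ioD lerDl io_ge0 addrC addKr.
Qed.

Lemma mminus_eq0 a b : mminus a b = m0 <-> io a <= io b.
Proof.
split=> [e|h].
  have := io_minus a b; rewrite e io0; case: ifP => h; first by lra.
  by move=> _; move/negbT: h; rewrite -ltNge => /ltW.
by apply: io_inj; rewrite io_minus io0; case: ifP => h'; lra.
Qed.

End Arithmetic.

(** * Coded rationals in a model *)

Section Rationals.
Variable M : model.
Hypothesis hM : models RCA0w M.

Local Notation enil := (@enil M).
Local Notation e1 x := (econs x enil).
Local Notation e2 x y := (econs y (econs x enil)).
Local Notation m0 := (mZero M).
Local Notation m1 := (mOne M).
Local Notation K := (K hM).
Local Notation io := (io hM).
Local Notation S n := (madd n m1).

(** Induction in the model speaks of its own elements, so a function on numbers is usable there only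
    if it is one of them. *)
Definition dfn s (f : M N -> M s) : Prop :=
  exists F : M (Arr N s), forall n, ap F n = f n.

Lemma dfn_id : dfn (fun n => n).
Proof. by exists (ev enil (lam v0)) => n; rewrite ev_lam. Qed.

Lemma dfn_const s (a : M s) : dfn (fun _ => a).
Proof. by exists (ap (mPi M s N) a) => n; rewrite m_PiE. Qed.

Lemma dfn_ap s t (f : M N -> M (Arr s t)) (g : M N -> M s) :
  dfn f -> dfn g -> dfn (fun n => ap (f n) (g n)).
Proof.
move=> [F hF] [G hG]; exists (ap (ap (mSig M N s t) F) G) => n.
by rewrite m_SigE // hF hG.
Qed.

Lemma dfn_ev1 s t (f : M N -> M s) (a : tm [:: s] t) :
  dfn f -> dfn (fun n => ev (e1 (f n)) a).
Proof.
move=> hf; have [F hF] := dfn_ap (dfn_const (ev enil (lam a))) hf.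
by exists F => n; rewrite hF ev_lam.
Qed.

Lemma dfn_ev2 s t u (f : M N -> M s) (g : M N -> M t) (a : tm [:: t; s] u) :
  dfn f -> dfn g -> dfn (fun n => ev (e2 (f n) (g n)) a).
Proof.
move=> hf hg.
have [F hF] := dfn_ap (dfn_ap (dfn_const (ev enil (lam (lam a)))) hf) hg.
by exists F => n; rewrite hF !ev_lam.
Qed.

Lemma dfn_add f g : dfn f -> dfn g -> dfn (fun n => madd (f n) (g n)).
Proof. by move=> hf hg; apply: dfn_ap hg; apply: dfn_ap hf; apply: dfn_const. Qed.

Lemma dfn_mul f g : dfn f -> dfn g -> dfn (fun n => mmul (f n) (g n)).
Proof. by move=> hf hg; apply: dfn_ap hg; apply: dfn_ap hf; apply: dfn_const. Qed.

Lemma dfn_minus f g : dfn f -> dfn g -> dfn (fun n => mminus (f n) (g n)).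
Proof. exact: dfn_ev2. Qed.

(** A quantifier-free predicate has a characteristic function, with value 0 at
    the elements satisfying it. *)
Definition qfp (P : M N -> Prop) : Prop :=
  exists F : M N1, forall n, P n <-> ap F n = m0.

(** The characteristic function of [P] enters the induction formula as a parameter. *)
Lemma qfp_ind P : qfp P -> P m0 -> (forall n, P n -> P (S n)) -> forall n, P n.
Proof.
move=> [F hF] P0 PS n; apply/hF.
apply: (@qf_ind _ hM [:: N1] (Eq0 (app v1 v0) cZero) (e1 F)) => //.
  exact/hF.
by move=> k /(hF k) /PS /hF.
Qed.

Lemma qfp_eq0 P f : dfn f -> (forall n, P n <-> f n = m0) -> qfp P.
Proof. by move=> [F hF] h; exists F => n; rewrite hF. Qed.

Lemma qfp_le f g : dfn f -> dfn g -> qfp (fun n => io (f n) <= io (g n)).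
Proof.
move=> hf hg; apply: (qfp_eq0 (dfn_minus hf hg)) => n.
exact: iff_sym (mminus_eq0 hM _ _).
Qed.

Lemma io_eq0 n : io n = 0 <-> n = m0.
Proof. by split=> [|->]; rewrite -(io0 hM) // => /io_inj. Qed.

Lemma qfp_not P : qfp P -> qfp (fun n => ~ P n).
Proof.
move=> [F hF]; apply: (qfp_eq0 (f := fun n => mminus m1 (ap F n))).
  by apply: dfn_minus; [apply: dfn_const|exists F].
move=> n; rewrite (mminus_eq0 hM) (io1 hM) hF -io_eq0; split=> h.
  have : 0 < io (ap F n) by rewrite lt0r io_ge0 andbT; apply/eqP.
  by rewrite -(io0 hM) => /io_ltS; rewrite io0 add0r.
by move=> e; move: h; rewrite e ler10.
Qed.

Lemma qfp_and P Q : qfp P -> qfp Q -> qfp (fun n => P n /\ Q n).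
Proof.
move=> [F hF] [G hG]; apply: (qfp_eq0 (f := fun n => madd (ap F n) (ap G n))).
  by apply: dfn_add; [exists F|exists G].
move=> n; rewrite hF hG -!io_eq0 ioD.
have := io_ge0 hM (ap F n); have := io_ge0 hM (ap G n).
by split=> [[-> ->]|h]; [rewrite addr0|split; lra].
Qed.

Lemma qfp_ext P Q : (forall n, P n <-> Q n) -> qfp P -> qfp Q.
Proof. by move=> h [F hF]; exists F => n; rewrite -h. Qed.

Lemma qfp_lt f g : dfn f -> dfn g -> qfp (fun n => io (f n) < io (g n)).
Proof.
move=> hf hg; apply: qfp_ext (qfp_not (qfp_le hg hf)) => n.
by rewrite real_ltNge ?num_real //; split=> /negP.
Qed.

Lemma ev_add G (e : env M G) t u : ev e (app (app cAdd t) u) = madd (ev e t) (ev e u).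
Proof. by []. Qed.
Lemma ev_mul G (e : env M G) t u : ev e (app (app cMul t) u) = mmul (ev e t) (ev e u).
Proof. by []. Qed.

(** * Conditionals, square roots and powers of two *)

Lemma ev_cond0 G (e : env M G) t a b :
  ev e t = m0 -> ev e (tcond t a b) = ev e a.
Proof.
move=> e0; rewrite -[LHS]/(mrec (ev e (lam (lam (twk (twk b))))) (ev e a) (ev e t)).
by rewrite e0 m_rec0.
Qed.

Lemma ev_condS G (e : env M G) t a b :
  ev e t <> m0 -> ev e (tcond t a b) = ev e b.
Proof.
move=> e0; rewrite -[LHS]/(mrec (ev e (lam (lam (twk (twk b))))) (ev e a) (ev e t)).
case: (m_predP hM (ev e t)) => // ->.
by rewrite m_recS // !ev_lam // !ev_twk.
Qed.

Definition msqrt (n : M N) : M N := ev (e1 n) (tsqrt v0).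
Definition mpow2 (n : M N) : M N := ev (e1 n) (tpow2 v0).

Lemma ev_closed1 G (e : env M G) s t (a : tm [:: s] t) (b : tm G s) :
  ev e (tsub (vcase b (fun s x => False_rect _ (var_nil x))) a) = ev (e1 (ev e b)) a.
Proof.
rewrite ev_tsub; congr (ev _ a).
by apply: fun_var_cons_ext => // u x; case: (var_nil x).
Qed.

Lemma ev_sqrt G (e : env M G) t : ev e (tsqrt t) = msqrt (ev e t).
Proof. exact: (ev_closed1 e (tsqrt v0)). Qed.

Lemma ev_pow2 G (e : env M G) t : ev e (tpow2 t) = mpow2 (ev e t).
Proof. exact: (ev_closed1 e (tpow2 v0)). Qed.

Lemma msqrt0 : msqrt m0 = m0.
Proof. exact: m_rec0. Qed.

Definition tsqrt_step (G : ctx) : tm (N :: N :: G) N :=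
  let s := app (app cAdd v0) cOne in
  tcond (tminus (app (app cMul s) s) (app (app cAdd v1) cOne)) s v0.

Lemma ev_sqrt_step G (e : env M G) n s :
  io (ev (econs s (econs n e)) (tsqrt_step G)) =
  if (io s + 1) ^+ 2 <= io n + 1 then io s + 1 else io s.
Proof.
have et : ev (econs s (econs n e)) (tminus
    (app (app cMul (app (app cAdd v0) cOne)) (app (app cAdd v0) cOne))
    (app (app cAdd v1) cOne)) = mminus (mmul (S s) (S s)) (S n).
  exact: ev_minus.
have h := mminus_eq0 hM (mmul (S s) (S s)) (S n).
rewrite ioM !ioD io1 -expr2 in h; rewrite /tsqrt_step.
case: ifPn => [/h h'|/negP nh].
  by rewrite ev_cond0 ?et // ev_add ioD io1.
by rewrite ev_condS // et => /h.
Qed.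

Lemma msqrtS n : io (msqrt (S n)) =
  if (io (msqrt n) + 1) ^+ 2 <= io n + 1 then io (msqrt n) + 1 else io (msqrt n).
Proof.
rewrite -(ev_sqrt_step (e1 (S n))); congr io.
apply: etrans (m_recS hM (ev (e1 (S n)) (lam (lam (tsqrt_step _)))) _ _) _.
by rewrite !ev_lam.
Qed.

(** By discreteness n < (s + 1)^2 gives n + 1 <= (s + 1)^2, so raising the root by at most one per
    step suffices. *)
Lemma msqrtP n : io (msqrt n) ^+ 2 <= io n < (io (msqrt n) + 1) ^+ 2.
Proof.
pose P n := io (mmul (msqrt n) (msqrt n)) <= io n /\
            io n < io (mmul (S (msqrt n)) (S (msqrt n))).
suff : P n by rewrite /P !ioM !ioD io1 -!expr2 => -[-> ->].
have dsq : dfn msqrt by apply: dfn_ev1 dfn_id.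
have dsqS : dfn (fun n => S (msqrt n)) by apply: dfn_add dsq (dfn_const _).
move: n; apply: qfp_ind.
- apply: qfp_and; first by apply: qfp_le dfn_id; apply: dfn_mul.
  by apply: qfp_lt dfn_id _; apply: dfn_mul.
- by rewrite /P msqrt0 !ioM !ioD io0 io1 add0r mul0r mulr1 lexx ltr01.
move=> n [h1 h2]; rewrite /P !ioM !ioD io1 msqrtS -!expr2.
have lt_n := io_ltS h2.
move: lt_n h1 {h2}; rewrite !ioM !ioD io1 -!expr2.
have := io_ge0 hM (msqrt n); move: (io (msqrt n)) (io n) => s k s0 lt_n h1.
case: ifPn => [h|]; first by split=> //; nra.
by rewrite -ltNge => h; split=> //; lra.
Qed.

Lemma mpow20 : mpow2 m0 = m1.
Proof. exact: m_rec0. Qed.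

Lemma mpow2S n : io (mpow2 (S n)) = 2 * io (mpow2 n).
Proof.
have -> : mpow2 (S n) = madd (mpow2 n) (mpow2 n).
  apply: etrans (m_recS hM (ev (e1 (S n)) (lam (lam (app (app cAdd v0) v0)))) _ _) _.
  by rewrite !ev_lam.
by rewrite ioD; ring.
Qed.

Lemma dfn_pow2 f : dfn f -> dfn (fun n => mpow2 (f n)).
Proof. exact: dfn_ev1. Qed.

Lemma mpow2_gt n : io n + 1 <= io (mpow2 n).
Proof.
suff : io (S n) <= io (mpow2 n) by rewrite ioD io1.
move: n; apply: qfp_ind.
- by apply: qfp_le; [apply: dfn_add dfn_id (dfn_const _)|apply: dfn_pow2 dfn_id].
- by rewrite mpow20 ioD io0 add0r.
move=> n; rewrite mpow2S !ioD io1; have := io_ge0 hM n; lra.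
Qed.

Lemma mpow2_gt0 n : 0 < io (mpow2 n).
Proof. have := mpow2_gt n; have := io_ge0 hM n; lra. Qed.

(** * Pairing *)

Definition mpair (i j : M N) : M N := madd (mmul (madd i j) (madd i j)) i.
Definition mfst (p : M N) : M N := mminus p (mmul (msqrt p) (msqrt p)).
Definition msnd (p : M N) : M N := mminus (msqrt p) (mfst p).

Lemma ev_fst G (e : env M G) t : ev e (tfst t) = mfst (ev e t).
Proof. by rewrite /tfst ev_minus ev_mul !ev_sqrt. Qed.
Lemma ev_snd G (e : env M G) t : ev e (tsnd t) = msnd (ev e t).
Proof. by rewrite /tsnd ev_minus ev_sqrt ev_fst. Qed.

(** (i + j)^2 <= (i + j)^2 + i < (i + j + 1)^2. *)
Lemma msqrt_pair i j : msqrt (mpair i j) = madd i j.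
Proof.
apply: (@io_inj _ hM); apply/eqP; rewrite eq_le.
have /andP [] := msqrtP (mpair i j).
have := io_ge0 hM (msqrt (mpair i j)); have := io_ge0 hM (madd i j).
have := io_ge0 hM i; have := io_ge0 hM j.
move=> j0 i0 ij0 s0 h1 h2.
have ep : io (mpair i j) = io (madd i j) ^+ 2 + io i by rewrite /mpair (ioD hM (mmul _ _)) ioM expr2.
have ij : io (madd i j) = io i + io j by rewrite ioD.
rewrite ep in h1 h2.
(* If the two numbers differed, one would exceed the other by a full unit, against the bounds of
   [msqrtP]. *)
by apply/andP; split; rewrite leNgt; apply/negP => /io_ltS h; nra.
Qed.

Lemma mfst_pair i j : mfst (mpair i j) = i.
Proof.
apply: (@io_inj _ hM); rewrite /mfst msqrt_pair io_minus /mpair ioD.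
by rewrite lerDl io_ge0 addrC addKr.
Qed.

Lemma msnd_pair i j : msnd (mpair i j) = j.
Proof.
apply: (@io_inj _ hM); rewrite /msnd mfst_pair msqrt_pair io_minus ioD.
by rewrite lerDl io_ge0 addrC addKr.
Qed.

(** * Values of coded rationals *)

Definition mval (q : M N) : K :=
  (io (mfst (mfst q)) - io (msnd (mfst q))) / (io (msnd q) + 1).

Definition mrat (a b c : M N) : M N := mpair (mpair a b) c.

Lemma mval_rat a b c : mval (mrat a b c) = (io a - io b) / (io c + 1).
Proof. by rewrite /mval /mrat !(mfst_pair, msnd_pair). Qed.

Lemma ev_rat G (e : env M G) a b c : ev e (qrat a b c) = mrat (ev e a) (ev e b) (ev e c).
Proof. by []. Qed.

Definition mpos q := mfst (mfst q).
Definition mneg q := msnd (mfst q).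
Definition mden q := madd (msnd q) m1.

Lemma ev_pos G (e : env M G) t : ev e (qpos t) = mpos (ev e t).
Proof. by rewrite /qpos !ev_fst. Qed.
Lemma ev_neg G (e : env M G) t : ev e (qneg t) = mneg (ev e t).
Proof. by rewrite /qneg ev_snd ev_fst. Qed.
Lemma ev_den G (e : env M G) t : ev e (qden t) = mden (ev e t).
Proof. by rewrite /qden ev_add ev_snd. Qed.

Lemma mden_gt0 q : 0 < io (mden q).
Proof. by rewrite /mden ioD io1; have := io_ge0 hM (msnd q); lra. Qed.

Lemma io_den q : io (mden q) = io (msnd q) + 1.
Proof. by rewrite /mden ioD io1. Qed.

Lemma mvalE q : mval q = (io (mpos q) - io (mneg q)) / io (mden q).
Proof. by rewrite /mden ioD io1. Qed.

(** Denominators are coded by their predecessors, and truncation does no harm at positive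
    numbers. *)
Lemma io_pred_gt0 n : 0 < io n -> io (mpred n) + 1 = io n.
Proof.
move=> h; rewrite io_pred ?subrK // => e.
by move: h; rewrite e io0 ltxx.
Qed.

Lemma val_q0 G (e : env M G) : mval (ev e q0) = 0.
Proof. by rewrite /q0 ev_rat mval_rat subrr mul0r. Qed.

Lemma val_half G (e : env M G) n : mval (ev e (qhalf n)) = (io (mpow2 (ev e n)))^-1.
Proof.
rewrite /qhalf ev_rat mval_rat ev_pred ev_pow2 io_pred_gt0 ?mpow2_gt0 //.
by rewrite io0 io1 subr0 mul1r.
Qed.

Lemma val_half1 G (e : env M G) n :
  mval (ev e (qhalf1 n)) = 2 * (io (mpow2 (ev e n)))^-1.
Proof.
rewrite /qhalf1 ev_rat mval_rat ev_pred ev_pow2 io_pred_gt0 ?mpow2_gt0 //.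
by rewrite io0 ev_add ioD io1 subr0.
Qed.

Lemma val_sub G (e : env M G) q r :
  mval (ev e (qsub q r)) = mval (ev e q) - mval (ev e r).
Proof.
rewrite /qsub ev_rat mval_rat ev_pred !(ev_add, ev_mul, ev_pos, ev_neg, ev_den).
rewrite io_pred_gt0; last by rewrite ioM mulr_gt0 ?mden_gt0.
have := mden_gt0 (ev e q); have := mden_gt0 (ev e r).
rewrite !(ioD, ioM) !mvalE !io_den !io1 => dr dq; field.
by rewrite !gt_eqF.
Qed.

Lemma val_abs G (e : env M G) q : mval (ev e (qabs q)) = `|mval (ev e q)|.
Proof.
rewrite /qabs ev_rat mval_rat (ev_snd e q) ev_add (ev_minus e (qpos q) (qneg q)) (ev_minus e (qneg q) (qpos q)) !(ev_pos, ev_neg) io0 subr0.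
rewrite mvalE normrM normfV -io_den (ioD hM (mminus _ _)) (gtr0_norm (mden_gt0 _)).
set p := mpos (ev e q); set n := mneg (ev e q).
(* At most one of the two truncated differences is nonzero, so their sum is the distance. *)
rewrite (io_minus hM p n) (io_minus hM n p); congr (_ / _).
by case: ler0P => h; case: ifPn => h1; case: ifPn => h2;
  move: h1 h2; rewrite -?ltNge; lra.
Qed.

Lemma val_lt (q r : M N) : mval q < mval r <->
  io (mpos q) * io (mden r) + io (mneg r) * io (mden q) <
  io (mpos r) * io (mden q) + io (mneg q) * io (mden r).
Proof.
rewrite !mvalE ltr_pdivrMr ?mden_gt0 // mulrAC ltr_pdivlMr ?mden_gt0 //.
by split; lra.
Qed.

Lemma sat_qlt G (e : env M G) q r :
  sat e (qlt q r) <-> mval (ev e q) < mval (ev e r).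
Proof.
rewrite val_lt -!ioM -!ioD -(io_lt hM).
by rewrite -!ev_pos -!ev_neg -!ev_den.
Qed.

(** [qle] is a disjunction in the object language, so the comparison goes through trichotomy of the
    two cross products. *)
Lemma sat_qle G (e : env M G) q r :
  sat e (qle q r) <-> mval (ev e q) <= mval (ev e r).
Proof.
have -> : mval (ev e q) <= mval (ev e r) = ~~ (mval (ev e r) < mval (ev e q)).
  by rewrite -leNgt.
pose t := app (app cAdd (app (app cMul (qpos q)) (qden r))) (app (app cMul (qneg r)) (qden q)).
pose u := app (app cAdd (app (app cMul (qpos r)) (qden q))) (app (app cMul (qneg q)) (qden r)).
rewrite -[sat _ _]/(mLt (ev e t) (ev e u) \/ ev e t = ev e u).
have hlt : mLt (ev e u) (ev e t) <-> mval (ev e r) < mval (ev e q) by apply: sat_qlt.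
split=> [h|/negP h].
  apply/negP => /hlt h'; case: h => [h|e'].
    exact: m_ltirr (m_lttrans hM h h').
  by move: h'; rewrite e' => /(m_ltirr hM).
by case: (m_lttotal hM (ev e t) (ev e u)) => [|[|/hlt //]]; [left|right].
Qed.

End Rationals.

(** * Reals in a model *)

Section Reals.
Variable M : model.
Hypothesis hM : models RCA0w M.

Local Notation enil := (@enil M).
Local Notation e1 x := (econs x enil).
Local Notation e2 x y := (econs y (econs x enil)).
Local Notation m0 := (mZero M).
Local Notation m1 := (mOne M).
Local Notation K := (K hM).
Local Notation io := (io hM).
Local Notation mval := (mval hM).
Local Notation S n := (madd n m1).

Definition hf (n : M N) : K := (io (mpow2 n))^-1.
Definition rv (x : M N1) (n : M N) : K := mval (ap x n).

Lemma hf_gt0 n : 0 < hf n.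
Proof. by rewrite invr_gt0 mpow2_gt0. Qed.

Lemma hf_S n : hf n = 2 * hf (S n).
Proof.
rewrite /hf mpow2S; have := mpow2_gt0 hM n => h.
by field; rewrite gt_eqF.
Qed.

Lemma hf_add n i : hf (madd n i) <= hf n.
Proof.
have h := @qf_ind _ hM [:: N] (qle (qhalf (app (app cAdd v1) v0)) (qhalf v1)) (e1 n).
have {}h : forall i, sat (econs i (e1 n)) (qle (qhalf (app (app cAdd v1) v0)) (qhalf v1)).
  apply: h => // [|k]; rewrite !(sat_qle hM) !val_half.
    by rewrite -[ev _ _]/(madd n m0) m_addC // m_add0.
  rewrite -[ev _ v1]/n -[ev _ _]/(madd n k) -[ev _ _]/(madd n (S k)).
  rewrite -/(hf n) -/(hf (madd n k)) -/(hf (madd n (S k))) => h.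
  rewrite m_addA //; have := hf_S (madd n k); have := hf_gt0 (S (madd n k)); lra.
by have := h i; rewrite (sat_qle hM) !val_half.
Qed.

Lemma io_leP n m : io n <= io m <-> exists i, m = madd n i.
Proof.
split=> [h|[i ->]]; last by rewrite ioD lerDl io_ge0.
exists (mminus m n); case: (m_minusP hM m n) => [//|[_ /(io_lt hM)]].
by rewrite ltNge h.
Qed.

Lemma hf_anti n m : io n <= io m -> hf m <= hf n.
Proof. by move=> /io_leP [i ->]; apply: hf_add. Qed.

(** 2^k is at least k + 1, and one more halving makes the inequality strict. *)
Lemma hf_arch (d : K) : 0 < d -> exists k, hf k < d.
Proof.
move=> /io_arch [k hk]; exists (S k).
have h : hf k <= d.
  apply: le_trans hk; rewrite lef_pV2 ?posrE ?mpow2_gt0 ?mpow2_gt //.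
  by have := io_ge0 hM k; lra.
by have := hf_S k; have := hf_gt0 (S k); lra.
Qed.

Definition isreal (x : M N1) : Prop := forall n i, `|rv x n - rv x (madd n i)| < hf n.
Definition reqv (x y : M N1) : Prop := forall n, `|rv x n - rv y n| <= 2 * hf n.

Lemma sat_is_real G (e : env M G) t : sat e (is_real t) <-> isreal (ev e t).
Proof.
have h n i : sat (econs i (econs n e)) (qlt (qabs (qsub (app (twk (twk t)) v1)
    (app (twk (twk t)) (app (app cAdd v1) v0)))) (qhalf v1)) <->
    `|rv (ev e t) n - rv (ev e t) (madd n i)| < hf n.
  rewrite (sat_qlt hM) val_abs val_sub val_half.
  by rewrite -[ev _ (app _ v1)]/(ap (ev _ (twk (twk t))) n)
    -[ev _ (app _ (app _ _))]/(ap (ev _ (twk (twk t))) (madd n i)) !ev_twk.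
by split=> H n i; apply/h; apply: H.
Qed.

Lemma sat_req G (e : env M G) t u : sat e (req t u) <-> reqv (ev e t) (ev e u).
Proof.
have h n : sat (econs n e) (qle (qabs (qsub (app (twk t) v0) (app (twk u) v0)))
    (qhalf1 v0)) <-> `|rv (ev e t) n - rv (ev e u) n| <= 2 * hf n.
  rewrite (sat_qle hM) val_abs val_sub val_half1.
  by rewrite -[ev _ (app (twk t) v0)]/(ap (ev _ (twk t)) n)
    -[ev _ (app (twk u) v0)]/(ap (ev _ (twk u)) n) !ev_twk.
by split=> H n; apply/h; apply: H.
Qed.

Lemma sat_rlt G (e : env M G) t u :
  sat e (rlt t u) <-> exists n, 2 * hf n < rv (ev e u) n - rv (ev e t) n.
Proof.
have h n : sat (econs n e) (qlt (qhalf1 v0) (qsub (app (twk u) v0) (app (twk t) v0)))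
    <-> 2 * hf n < rv (ev e u) n - rv (ev e t) n.
  rewrite (sat_qlt hM) val_sub val_half1.
  by rewrite -[ev _ (app (twk t) v0)]/(ap (ev _ (twk t)) n)
    -[ev _ (app (twk u) v0)]/(ap (ev _ (twk u)) n) !ev_twk.
by split=> -[n H]; exists n; apply/h.
Qed.

Lemma rv_rofq G (e : env M G) q n : rv (ev e (rofq q)) n = mval (ev e q).
Proof. by rewrite /rv /rofq ev_lam // ev_twk. Qed.

Lemma rv_rabs G (e : env M G) t n : rv (ev e (rabs t)) n = `|rv (ev e t) n|.
Proof.
rewrite /rv /rabs ev_lam // val_abs.
by rewrite -[ev _ (app (twk t) v0)]/(ap (ev _ (twk t)) n) ev_twk.
Qed.

Lemma rv_rsub G (e : env M G) t u n :
  rv (ev e (rsub t u)) n = rv (ev e t) (S n) - rv (ev e u) (S n).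
Proof.
rewrite /rv /rsub ev_lam // val_sub.
by rewrite -[ev _ (app (twk t) _)]/(ap (ev _ (twk t)) (S n))
  -[ev _ (app (twk u) _)]/(ap (ev _ (twk u)) (S n)) !ev_twk.
Qed.

(** * Sets, balls and limits *)

Definition inset (Y : M (Arr N1 N1)) (x : M N1) : Prop :=
  exists n, 2 * hf n < `|rv (ap Y x) n|.

(** The successor index is the shift built into [rsub]. *)
Definition inball (y x : M N1) (r : K) : Prop :=
  exists n, 2 * hf n < r - `|rv x (S n) - rv y (S n)|.

Lemma sat_set_of G (e : env M G) t x :
  sat (econs x e) (Defs.set_of t) <-> inset (ev e t) x.
Proof.
have h n : rv (ev (econs x e) (rabs (app (twk t) v0))) n -
    rv (ev (econs x e) (rofq q0)) n = `|rv (ap (ev e t) x) n|.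
  rewrite rv_rofq val_q0 subr0 rv_rabs.
  by rewrite -[ev _ (app (twk t) v0)]/(ap (ev _ (twk t)) x) ev_twk.
by rewrite /Defs.set_of sat_rlt; split=> -[n]; rewrite ?h => h'; exists n; rewrite ?h.
Qed.

Lemma sat_in_ball G (e : env M G) y x r :
  sat e (in_ball y x r) <-> inball (ev e y) (ev e x) (mval (ev e r)).
Proof.
rewrite /in_ball sat_rlt.
by split=> -[n h]; exists n; move: h; rewrite rv_rofq rv_rabs rv_rsub.
Qed.

(** [lim] takes the difference of the term and the limit in this order, which under the convention
    of [in_ball] places the limit in a ball around the term; [inball_swap] reverses the roles. *)
Definition limv (X : M (Arr N N1)) (l : M N1) : Prop :=
  forall k, exists n0, forall m, io n0 <= io m -> inball l (ap X m) (hf k).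

Lemma sat_le0 G (e : env M G) t u : sat e (Le0 t u) <-> io (ev e t) <= io (ev e u).
Proof.
split=> [[/(io_lt hM)/ltW //|/= ->]|]; first by [].
rewrite le_eqVlt => /orP [/eqP/io_inj|/(io_lt hM)]; by [right|left].
Qed.

Lemma sat_lim G (e : env M G) t u : sat e (lim t u) <-> limv (ev e t) (ev e u).
Proof.
have h k n0 m : sat (econs m (econs n0 (econs k e)))
    (Imp (Le0 v1 v0) (rlt (rabs (rsub (app (twk (twk (twk t))) v0) (twk (twk (twk u)))))
       (rofq (qhalf v2)))) <->
    (io n0 <= io m -> inball (ev e u) (ap (ev e t) m) (hf k)).
  rewrite -[sat _ _]/(sat (econs m (econs n0 (econs k e))) (Le0 v1 v0) ->
    sat (econs m (econs n0 (econs k e))) (in_ball (twk (twk (twk u)))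
      (app (twk (twk (twk t))) v0) (qhalf v2))).
  rewrite sat_le0 sat_in_ball val_half !ev_twk.
  by rewrite -[ev _ (app _ v0)]/(ap (ev _ (twk (twk (twk t)))) m) !ev_twk.
split=> H k; have [n0 {}H] := H k; exists n0 => m; apply/h; exact: H.
Qed.

Lemma sat_is_closed (Y : M (Arr N1 N1)) :
  sat (e1 Y) (is_closed (Defs.set_of v0)) <->
  forall x, isreal x -> ~ inset Y x -> exists r, 0 < mval r /\
    forall y, isreal y -> inball y x (mval r) -> ~ inset Y y.
Proof.
have hx (x : M N1) : sat (econs x (e1 Y)) (Defs.mem v0 (swk N1 (compl (Defs.set_of v0)))) <-> ~ inset Y x.
  rewrite /Defs.mem sat_inst /swk sat_fwk1.
  exact: (not_iff_compat (sat_set_of (e1 Y) v0 x)).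
have hy (x : M N1) (r : M N) (y : M N1) : sat (econs y (econs r (econs x (e1 Y))))
    (Defs.mem v0 (swk N1 (swk N (swk N1 (compl (Defs.set_of v0)))))) <-> ~ inset Y y.
  rewrite /Defs.mem sat_inst /swk 3!sat_fwk1.
  exact: (not_iff_compat (sat_set_of (e1 Y) v0 y)).
have hr (x : M N1) (r : M N) : sat (econs r (econs x (e1 Y))) (qlt q0 v0) <-> 0 < mval r.
  by rewrite (sat_qlt hM) val_q0.
have hb (x : M N1) (r : M N) (y : M N1) : sat (econs y (econs r (econs x (e1 Y)))) (in_ball v0 v2 v1) <->
    inball y x (mval r) by rewrite sat_in_ball.
have hyr (x : M N1) (r : M N) (y : M N1) : sat (econs y (econs r (econs x (e1 Y)))) (is_real v0) <-> isreal y.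
  by rewrite sat_is_real.
have hxr (x : M N1) : sat (econs x (e1 Y)) (is_real v0) <-> isreal x by rewrite sat_is_real.
split=> H x.
  move=> /hxr rx /hx nx; have [r [/hr r0 {}H]] := H x rx nx; exists r; split=> //.
  by move=> y /(hyr x r y) ry /(hb x r y) b; apply/(hy x r y); apply: H.
move=> /hxr rx /hx nx; have [r [/(hr x r) r0 {}H]] := H x rx nx; exists r; split=> //.
by move=> y /(hyr x r y) ry /hb b; apply/hy; apply: H.
Qed.

Lemma sat_is_seq_closed (Y : M (Arr N1 N1)) :
  sat (e1 Y) (is_seq_closed (Defs.set_of v0)) <->
  forall X l, (forall n, isreal (ap X n)) -> isreal l ->
    (forall n, inset Y (ap X n)) -> limv X l -> inset Y l.
Proof.
have hl (X : M (Arr N N1)) (l : M N1) : sat (econs l (econs X (e1 Y)))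
    (Defs.mem v0 (swk N1 (swk (Arr N N1) (Defs.set_of v0)))) <-> inset Y l.
  by rewrite /Defs.mem sat_inst /swk 2!sat_fwk1 sat_set_of.
have hX (X : M (Arr N N1)) (l : M N1) (n : M N) : sat (econs n (econs l (econs X (e1 Y))))
    (Defs.mem (app v2 v0) (swk N (swk N1 (swk (Arr N N1) (Defs.set_of v0))))) <->
    inset Y (ap X n).
  by rewrite /Defs.mem sat_inst /swk 3!sat_fwk1 sat_set_of.
have hXr (X : M (Arr N N1)) (l : M N1) (n : M N) : sat (econs n (econs l (econs X (e1 Y)))) (is_real (app v2 v0)) <->
    isreal (ap X n) by rewrite sat_is_real.
have hlr (X : M (Arr N N1)) (l : M N1) : sat (econs l (econs X (e1 Y))) (is_real v0) <-> isreal l.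
  by rewrite sat_is_real.
have hlim (X : M (Arr N N1)) (l : M N1) : sat (econs l (econs X (e1 Y))) (lim v1 v0) <-> limv X l.
  by rewrite sat_lim.
split=> H X l.
  move=> rX /(hlr X) rl iX /hlim lX; apply/(hl X); apply: H => //.
    by move=> n; apply/hXr.
  by split=> // n; apply/hX.
move=> rX /hlr rl [iX /hlim lX]; apply/hl; apply: (H X l _ rl _ lX) => n.
  exact: (proj1 (hXr X l n) (rX n)).
exact: (proj1 (hX X l n) (iX n)).
Qed.

Lemma sat_is_rfun (Y : M (Arr N1 N1)) :
  sat (e1 Y) (is_rfun v0) <->
  (forall x, isreal x -> isreal (ap Y x)) /\
  (forall x y, isreal x -> isreal y -> reqv x y -> reqv (ap Y x) (ap Y y)).
Proof.
have h1 (x : M N1) : sat (econs x (e1 Y)) (is_real v0) <-> isreal x by rewrite sat_is_real.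
have h2 (x : M N1) : sat (econs x (e1 Y)) (is_real (app (twk v0) v0)) <-> isreal (ap Y x).
  by rewrite sat_is_real.
have h3 (x y : M N1) : sat (econs y (econs x (e1 Y))) (is_real v1) <-> isreal x.
  by rewrite sat_is_real.
have h4 (x y : M N1) : sat (econs y (econs x (e1 Y))) (is_real v0) <-> isreal y.
  by rewrite sat_is_real.
have h5 (x y : M N1) : sat (econs y (econs x (e1 Y))) (req v1 v0) <-> reqv x y.
  by rewrite sat_req.
have h6 (x y : M N1) : sat (econs y (econs x (e1 Y)))
    (req (app (twk (twk v0)) v1) (app (twk (twk v0)) v0)) <-> reqv (ap Y x) (ap Y y).
  by rewrite sat_req.
split=> -[H H']; split.
- by move=> x /h1 rx; apply/h2; apply: H.
- by move=> x y /(h3 x y) rx /(h4 x y) ry /h5 xy; apply/h6; apply: H'.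
- by move=> x /h1 rx; apply/h2; apply: H.
- by move=> x y /h3 rx /h4 ry /h5 xy; apply/h6; apply: H'.
Qed.

End Reals.

(** One step of a telescoping bound: d = 2^-n, e = 2^-j and f = 2^-(j+1), where j is the index
    reached so far. *)
Lemma fast_sum_step (R : realFieldType) (a b c d e f : R) :
  `|a - b| <= d - e -> `|c - b| < f -> e = 2 * f -> `|a - c| <= d - f.
Proof.
move=> h1 h2 h3; have h4 := ler_distD b a c; rewrite (distrC b) in h4.
by lra.
Qed.

(** Moving both points costs less than 2e of the margin 2d = 4e and leaves 2e; with d = 2^-n this is
    a witness at index n + 1. *)
Lemma dist_ball_step (R : realFieldType) (a a' b b' d e k : R) :
  `|a - a'| < e -> `|b - b'| < e -> d = 2 * e -> 2 * d < k - `|a - b| ->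
  2 * e < k - `|a' - b'|.
Proof.
move=> h1 h2 h3 h4.
have h5 := ler_distD a a' b'; have h6 := ler_distD b a b'.
by rewrite (distrC a' a) in h5; lra.
Qed.

(** The margin 2d = 8f loses less than 4f, then at most 2f, and 2f remains; this is why a witness of
    membership moves up by two indices. *)
Lemma norm_gt_step (R : realFieldType) (a a' b d e f : R) :
  `|a - a'| < d -> `|a' - b| <= 2 * f -> d = 2 * e -> e = 2 * f -> 0 < f ->
  2 * d < `|a| -> 2 * f < `|b|.
Proof.
move=> h1 h2 h3 h4 f0 h5.
have h6 := ler_normD (a - a') a'; have h7 := ler_normD (a' - b) b.
by rewrite !subrK in h6 h7; lra.
Qed.

(** * Forcing a sequence to converge fast *)

(** A characteristic term for q < r, with value 0 when it holds: by discreteness the strict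
    inequality of cross products is a weak one after adding 1 on the left. *)
Definition qltc (G : ctx) (q r : tm G N) : tm G N :=
  tminus
    (app (app cAdd (app (app cAdd (app (app cMul (qpos q)) (qden r)))
                                  (app (app cMul (qneg r)) (qden q)))) cOne)
    (app (app cAdd (app (app cMul (qpos r)) (qden q)))
                   (app (app cMul (qneg q)) (qden r))).

Definition tforce_step (G : ctx) (z : tm (N :: N :: G) N1) : tm (N :: N :: G) N :=
  tcond (qltc (qabs (qsub (app z (app (app cAdd v1) cOne)) v0))
              (qhalf (app (app cAdd v1) cOne)))
        (app z (app (app cAdd v1) cOne)) v0.

(** Keeps the next entry of [z] when it is close enough to the current value.
    The result is a real for every [z], and is [z] itself when [z] already
    satisfies the tests: this turns quantifiers over reals into quantifiers
    over all objects of type 1, leaving a quantifier-free matrix. *)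
Definition tforce (G : ctx) (z : tm G N1) : tm G N1 :=
  app (app cRec (lam (lam (tforce_step (twk (twk z)))))) (app z cZero).

Definition tshift (G : ctx) (z : tm G N1) : tm G N1 :=
  lam (app (twk z) (app (app cAdd v0) cOne)).

Section Forcing.
Variable M : model.
Hypothesis hM : models RCA0w M.

Local Notation enil := (@enil M).
Local Notation e1 x := (econs x enil).
Local Notation e2 x y := (econs y (econs x enil)).
Local Notation m0 := (mZero M).
Local Notation m1 := (mOne M).
Local Notation K := (K hM).
Local Notation io := (io hM).
Local Notation mval := (mval hM).
Local Notation hf := (hf hM).
Local Notation rv := (rv hM).
Local Notation isreal := (isreal hM).
Local Notation S n := (madd n m1).

Lemma ev_qltc G (e : env M G) q r :
  ev e (qltc q r) = m0 <-> mval (ev e q) < mval (ev e r).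
Proof.
rewrite /qltc ev_minus (mminus_eq0 hM) val_lt !ev_add !ev_mul !ev_pos !ev_neg !ev_den.
rewrite -!ioM -!(ioD hM (mmul _ _)) (ioD hM (madd _ _)) io1.
split=> h; last exact: io_ltS.
by apply: lt_le_trans h; rewrite ltrDl.
Qed.

Lemma ev_force_step G (e : env M G) z n v :
  ev (econs v (econs n e)) (tforce_step (twk (twk z))) =
  if `|rv (ev e z) (S n) - mval v| < hf (S n) then ap (ev e z) (S n) else v.
Proof.
set b := econs v (econs n e).
have en : ev b (app (twk (twk z)) (app (app cAdd v1) cOne)) = ap (ev e z) (S n).
  by rewrite -[LHS]/(ap (ev b (twk (twk z))) (S n)) !ev_twk.
rewrite /tforce_step.
have := ev_qltc b (qabs (qsub (app (twk (twk z)) (app (app cAdd v1) cOne)) v0))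
  (qhalf (app (app cAdd v1) cOne)).
rewrite val_abs val_sub val_half en -[ev b v0]/v -/(hf _) -/(rv _ _) => h.
case: ifPn => [/h c|/negP c]; first by rewrite ev_cond0.
by rewrite ev_condS // => /h.
Qed.

Lemma ev_force0 G (e : env M G) z : ap (ev e (tforce z)) m0 = ap (ev e z) m0.
Proof. exact: m_rec0. Qed.

Lemma ev_forceS G (e : env M G) z n :
  ap (ev e (tforce z)) (S n) =
  if `|rv (ev e z) (S n) - rv (ev e (tforce z)) n| < hf (S n)
  then ap (ev e z) (S n) else ap (ev e (tforce z)) n.
Proof.
apply: etrans (m_recS hM (ev e (lam (lam (tforce_step (twk (twk z)))))) _ _) _.
by rewrite !ev_lam // ev_force_step.
Qed.

(** An accepted entry has passed this very test; a rejected one repeats the old value, at distance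
    0. *)
Lemma rv_forceS G (e : env M G) z n (w := ev e (tforce z)) :
  `|rv w (S n) - rv w n| < hf (S n).
Proof.
rewrite {1}/rv /w ev_forceS; case: ifP => // _.
by rewrite -/(rv _ _) subrr normr0 hf_gt0.
Qed.

(** The bound 2^-n is not inductive; the sum of the single steps, 2^-n - 2^-(n+i), is. *)
Lemma isreal_of_step (w : M N1) :
  (forall n, `|rv w (S n) - rv w n| < hf (S n)) -> isreal w.
Proof.
move=> hw n i.
suff : `|rv w n - rv w (madd n i)| <= hf n - hf (madd n i).
  by have := hf_gt0 hM (madd n i); lra.
pose A : fm [:: N; N; N1] :=
  qle (qabs (qsub (app v2 v1) (app v2 (app (app cAdd v1) v0))))
      (qsub (qhalf v1) (qhalf (app (app cAdd v1) v0))).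
have hA k : sat (econs k (e2 w n)) A <->
    `|rv w n - rv w (madd n k)| <= hf n - hf (madd n k).
  by rewrite (sat_qle hM) val_abs !val_sub !val_half.
have h0 : `|rv w n - rv w (madd n m0)| <= hf n - hf (madd n m0).
  by rewrite [madd n m0](m_addC hM) (m_add0 hM) !subrr normr0.
have hS k : `|rv w n - rv w (madd n k)| <= hf n - hf (madd n k) ->
    `|rv w n - rv w (madd n (S k))| <= hf n - hf (madd n (S k)).
  rewrite (m_addA hM); set j := madd n k => h.
  exact: fast_sum_step h (hw j) (hf_S hM j).
apply: (proj1 (hA i)).
apply: (@qf_ind _ hM [:: N; N1] A (e2 w n)) => //; first exact: (proj2 (hA m0) h0).
by move=> k /(proj1 (hA k)) hk; exact: (proj2 (hA (S k)) (hS k hk)).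
Qed.

Lemma isreal_force G (e : env M G) z : isreal (ev e (tforce z)).
Proof. by apply: isreal_of_step => n; apply: rv_forceS. Qed.

(** By induction the value kept so far is the previous entry of [z], so every test succeeds. *)
Lemma ev_force_id G (e : env M G) z :
  (forall n, `|rv (ev e z) (S n) - rv (ev e z) n| < hf (S n)) ->
  ev e (tforce z) = ev e z.
Proof.
move=> hz; apply: ap_ext => n.
have h := @qf_ind _ hM [:: N1; N1] (Eq0 (app v1 v0) (app v2 v0))
  (e2 (ev e z) (ev e (tforce z))).
apply: (h _ _ _ n) => //; first exact: ev_force0.
move=> k hk; have {}hk : ap (ev e (tforce z)) k = ap (ev e z) k by [].
change (ap (ev e (tforce z)) (S k) = ap (ev e z) (S k)).
by rewrite ev_forceS /rv hk -!/(rv _ _) hz.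
Qed.

(** [tforce] occurs in two contexts, in the choice formula and in the term defining the
    approximating sequence; this identifies the values. *)
Lemma ev_force_ext G D (e : env M G) (e' : env M D) z z' :
  ev e z = ev e' z' -> ev e (tforce z) = ev e' (tforce z').
Proof.
move=> ez.
have es : ev e (lam (lam (tforce_step (twk (twk z))))) =
          ev e' (lam (lam (tforce_step (twk (twk z'))))).
  by apply: ap_ext => n; apply: ap_ext => v; rewrite !ev_lam // !ev_force_step ez.
by rewrite -[LHS]/(ap (ap (mRec M) (ev e (lam (lam (tforce_step (twk (twk z)))))))
    (ap (ev e z) m0)) es ez.
Qed.

Lemma ev_shift G (e : env M G) z n : ap (ev e (tshift z)) n = ap (ev e z) (S n).
Proof.
by rewrite /tshift ev_lam // -[LHS]/(ap (ev _ (twk z)) (S n)) ev_twk.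
Qed.

Lemma isreal_step (y : M N1) n : isreal y -> `|rv y (S n) - rv y n| < hf n.
Proof. by move=> /(_ n m1); rewrite distrC. Qed.

Section Shift.
Variables (y w : M N1).
Hypothesis ry : isreal y.
Hypothesis wE : forall n, ap w n = ap y (S n).

Lemma rv_shift n : rv w n = rv y (S n).
Proof. by rewrite /rv wE. Qed.

(** This is the hypothesis of [ev_force_id], so shifted reals pass through [tforce] unchanged. *)
Lemma shift_step n : `|rv w (S n) - rv w n| < hf (S n).
Proof. by rewrite !rv_shift; apply: isreal_step. Qed.

Lemma isreal_shift : isreal w.
Proof. by apply: isreal_of_step; apply: shift_step. Qed.

Lemma reqv_shift : reqv hM y w.
Proof.
move=> n; rewrite rv_shift distrC.
by have := isreal_step n ry; have := hf_gt0 hM n; lra.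
Qed.

Lemma inball_shift x (k : K) : isreal x -> inball y x k -> inball w x k.
Proof.
move=> rx [n hn]; exists (S n); rewrite rv_shift.
apply: dist_ball_step (rx (S n) m1) _ (hf_S hM n) hn.
have := ry (S n) (S m1); by rewrite (m_addA hM).
Qed.

End Shift.

Lemma inset_req (Y : M (Arr N1 N1)) (y w : M N1) :
  isreal (ap Y y) -> isreal (ap Y w) -> reqv hM (ap Y y) (ap Y w) ->
  inset hM Y y -> inset hM Y w.
Proof.
rewrite /inset; move: (ap Y y) (ap Y w) => u v ru rv' uv [n hn].
exists (S (S n)); have h1 := ru n (S m1); rewrite (m_addA hM) in h1.
exact: (norm_gt_step h1 (uv _) (hf_S hM n) (hf_S hM (S n)) (hf_gt0 hM _) hn).
Qed.

End Forcing.

(** * Sequentially closed sets *)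

Section Main.
Variable M : model.
Hypothesis hM01 : models RCA0w_QFAC01 M.

Lemma models_RCA0w : models RCA0w M.
Proof. by move=> G A hA e; apply: hM01; left. Qed.

Local Notation hM := models_RCA0w.
Local Notation enil := (@enil M).
Local Notation e1 x := (econs x enil).
Local Notation e2 x y := (econs y (econs x enil)).
Local Notation m0 := (mZero M).
Local Notation m1 := (mOne M).
Local Notation io := (io hM).
Local Notation mval := (mval hM).
Local Notation hf := (hf hM).
Local Notation rv := (rv hM).
Local Notation isreal := (isreal hM).
Local Notation inset := (inset hM).
Local Notation S n := (madd n m1).

Lemma m_qfac01 G (A : fm (N1 :: N :: G)) (e : env M G) : qfree A ->
  (forall k, exists z, sat (econs z (econs k e)) A) ->
  exists Z : M (Arr N N1), forall k, sat (econs (ap Z k) (econs k e)) A.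
Proof.
move=> qA h.
have [Z hZ] : exists Z : M (Arr N N1), forall k, sat (econs k (econs Z e))
    (fsub (vcase (app v1 v0) (vcase v0 (fun _ x => tvar (vs (vs x))))) A).
  exact: (hM01 (or_intror (@QFAC_ax N N1 G A qA)) e h).
exists Z => k; have := hZ k; rewrite sat_fsub.
suff -> : (fun s x => ev (econs k (econs Z e))
    (vcase (P := tm [:: N, Arr N N1 & G]) (app v1 v0)
      (vcase v0 (fun _ x => tvar (vs (vs x)))) x)) =
  econs (ap Z k) (econs k e) by [].
by apply: fun_var_cons_eq => //; apply: fun_var_cons_eq.
Qed.

Variable Y : M (Arr N1 N1).

Definition sem_closed : Prop :=
  forall x, isreal x -> ~ inset Y x -> exists r, 0 < mval r /\
    forall y, isreal y -> inball y x (mval r) -> ~ inset Y y.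

Definition sem_seq_closed : Prop :=
  forall X l, (forall n, isreal (ap X n)) -> isreal l ->
    (forall n, inset Y (ap X n)) -> limv hM X l -> inset Y l.

Lemma inball_swap x y (r s : K hM) : r <= s -> inball y x r -> inball x y s.
Proof.
move=> rs [n hn]; exists n; rewrite distrC.
by apply: lt_le_trans hn _; rewrite lerD2r.
Qed.

Lemma seq_closed_of_closed : sem_closed -> sem_seq_closed.
Proof.
move=> cY X l rX rl iX lX; apply: contrapT => nl.
have [r [r0 hr]] := cY l rl nl.
have [k /ltW hk] := hf_arch r0; have [n0 hn] := lX k.
(* The term at index [n0] lies both in the set and in the ball that avoids it. *)
exact: (hr _ (rX n0) (inball_swap hk (hn n0 (lexx _))) (iX n0)).
Qed.

(** * The choice formula *)

Local Notation actx := [:: N1; N; N1; Arr N1 N1].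

Definition tapprox : tm actx N1 := tforce (tshift v0).
Definition twit1 : tm actx N := tfst (app v0 cZero).
Definition twit2 : tm actx N := tsnd (app v0 cZero).

(** The point coded by [z] is the sequence z(1), z(2), ..., made a real by
    [tforce]; the number z(0) codes the witnesses that it lies in the set and
    in the ball of radius 2^-k around [x].  *)
Definition approx_fm : fm actx :=
  And (qlt (qhalf1 twit1) (qabs (app (app v3 tapprox) twit1)))
      (qlt (qhalf1 twit2) (qsub (qhalf v1)
        (qabs (qsub (app v2 (app (app cAdd twit2) cOne))
                    (app tapprox (app (app cAdd twit2) cOne)))))).

Local Notation aenv x k z := (econs z (econs k (e2 Y x))).

Lemma sat_approx x k z (w := ev (aenv x k z) tapprox)
    (n := mfst (ap z m0)) (m := msnd (ap z m0)) :
  sat (aenv x k z) approx_fm <->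
  2 * hf n < `|rv (ap Y w) n| /\ 2 * hf m < hf k - `|rv x (S m) - rv w (S m)|.
Proof.
have en : ev (aenv x k z) twit1 = n by apply: ev_fst.
have em : ev (aenv x k z) twit2 = m by apply: ev_snd.
have h1 : sat (aenv x k z) (qlt (qhalf1 twit1) (qabs (app (app v3 tapprox) twit1))) <->
    2 * hf n < `|rv (ap Y w) n|.
  rewrite (sat_qlt hM) val_half1 val_abs en.
  by rewrite -[ev _ (app (app _ _) _)]/(ap (ap Y w) (ev (aenv x k z) twit1)) en.
have h2 : sat (aenv x k z) (qlt (qhalf1 twit2) (qsub (qhalf v1)
        (qabs (qsub (app v2 (app (app cAdd twit2) cOne))
                    (app tapprox (app (app cAdd twit2) cOne)))))) <->
    2 * hf m < hf k - `|rv x (S m) - rv w (S m)|.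
  rewrite (sat_qlt hM) val_half1 val_sub val_half val_abs val_sub em.
  rewrite -[ev _ (app v2 _)]/(ap x (S (ev (aenv x k z) twit2))).
  by rewrite -[ev _ (app tapprox _)]/(ap w (S (ev (aenv x k z) twit2))) em.
split=> [[/h1 h /h2 h']|[/h1 h /h2 h']]; by split.
Qed.

(** Puts the code of the witnesses in front of a sequence; [tshift] undoes this. *)
Definition tcons : tm [:: N1; N] N1 :=
  lam (tcond v0 v2 (app v1 (tpred v0))).

(** The point [y] may fail the tests of [tforce]; its shift [w] is the same real, passes them, and
    inherits membership and nearness, with witnesses of its own. *)
Lemma approx_ex x k y :
  (forall x, isreal x -> isreal (ap Y x)) ->
  (forall x y, isreal x -> isreal y -> reqv hM x y -> reqv hM (ap Y x) (ap Y y)) ->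
  isreal x -> isreal y -> inball y x (hf k) -> inset Y y ->
  exists z, sat (aenv x k z) approx_fm.
Proof.
move=> rY eY rx ry by_ iy; pose w := ev (e1 y) (tshift v0).
have wE n : ap w n = ap y (S n) by exact: ev_shift hM _ _ _ _.
have rw := isreal_shift ry wE.
have [m hm] := inball_shift ry wE rx by_.
have [n hn] : inset Y w.
  by apply: inset_req iy; [exact: rY|exact: rY|apply: eY => //; apply: reqv_shift].
pose z := ev (e2 (mpair n m) w) tcons.
have zE j : ap z j =
    ev (econs j (e2 (mpair n m) w)) (tcond v0 v2 (app v1 (tpred v0))).
  exact (ev_lam hM (e2 (mpair n m) w) (tcond v0 v2 (app v1 (tpred v0))) j).
have z0 : ap z m0 = mpair n m by rewrite zE (ev_cond0 hM).
have zS j : ap z (S j) = ap w j.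
  rewrite zE (ev_condS hM).
    rewrite -[LHS]/(ap w (ev (econs (S j) (e2 (mpair n m) w)) (tpred v0))) ev_pred.
    by rewrite -[ev _ v0]/(S j) (m_predS hM).
  (* A successor is nonzero, so the conditional takes its second branch. *)
  rewrite -[ev _ v0]/(S j) => /(congr1 io); rewrite ioD io0 io1 => e.
  by have := ltr_wpDl (io_ge0 hM j) (@ltr01 (K hM)); rewrite e ltxx.
have ew : ev (aenv x k z) (tshift v0) = w.
  by apply: ap_ext => j; rewrite (ev_shift hM) -zS.
have ea : ev (aenv x k z) tapprox = w.
  have h := @ev_force_id M hM _ (aenv x k z) (tshift v0).
  rewrite ew in h; exact (h (shift_step ry wE)).
exists z; apply/sat_approx; rewrite ea z0 (mfst_pair hM) (msnd_pair hM).
by split.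
Qed.

Lemma closed_of_seq_closed :
  (forall x, isreal x -> isreal (ap Y x)) ->
  (forall x y, isreal x -> isreal y -> reqv hM x y -> reqv hM (ap Y x) (ap Y y)) ->
  sem_seq_closed -> sem_closed.
Proof.
move=> rY eY sY x rx nx; apply: contrapT => nball.
have near k : exists z, sat (aenv x k z) approx_fm.
  have [y ry [by_ iy]] : exists2 y, isreal y & inball y x (hf k) /\ inset Y y.
    (* If no such point existed, the radius 2^-k would give a ball around [x] avoiding the set. *)
    apply: contrapT => ny; apply: nball; exists (ev (e1 k) (qhalf v0)).
    rewrite val_half -[ev _ v0]/k -/(hf k); split; first exact: hf_gt0.
    by move=> y ry by_ iy; exact (ny (ex_intro2 _ _ y ry (conj by_ iy))).
  exact (approx_ex rY eY rx ry by_ iy).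
have [Z hZ] : exists Z : M (Arr N N1), forall k, sat (aenv x k (ap Z k)) approx_fm.
  by apply: (m_qfac01 _ near).
(* The forced points are given by one term with parameter [Z], so their sequence is an element of
   the model. *)
pose X := ev (e1 Z) (lam (tforce (tshift (app v1 v0)))).
have XE k : ap X k = ev (aenv x k (ap Z k)) tapprox.
  have et : ev (econs k (e1 Z)) (tshift (app v1 v0)) =
      ev (aenv x k (ap Z k)) (tshift v0).
    by apply: ap_ext => j; rewrite !(ev_shift hM).
  rewrite -(ev_force_ext hM et).
  exact (ev_lam hM (e1 Z) (tforce (tshift (app v1 v0))) k).
apply: nx; apply: (sY X).
- by move=> n; rewrite XE; apply: isreal_force.
- exact: rx.
- move=> n; have [h _] := proj1 (sat_approx _ _ _) (hZ n).
  rewrite XE; exists (mfst (ap (ap Z n) m0)); exact h.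
(* The identity is a modulus of convergence, since 2^-n <= 2^-k for n >= k. *)
move=> k; exists k => n kn; have [_ h] := proj1 (sat_approx _ _ _) (hZ n).
apply: (inball_swap (hf_anti kn)).
rewrite XE; exists (msnd (ap (ap Z n) m0)); exact h.
Qed.

End Main.

Theorem theorem4p14 : proves RCA0w_QFAC01 R_is_sequential.
Proof.
apply: completeness => [|G s t x y f|M hM e].
- exact: RCA0w_QFAC01_fsub.
- by left; apply: Extensionality.
have h Y : sat (econs Y (enil M)) (is_rfun v0) ->
    sat (econs Y (enil M)) (is_seq_closed (Defs.set_of v0)) <->
    sat (econs Y (enil M)) (is_closed (Defs.set_of v0)).
  move=> /(sat_is_rfun (models_RCA0w hM)) [rY eY].
  split=> [/(sat_is_seq_closed (models_RCA0w hM)) H|/(sat_is_closed (models_RCA0w hM)) H].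
    by apply/(sat_is_closed (models_RCA0w hM)); apply: closed_of_seq_closed.
  by apply/(sat_is_seq_closed (models_RCA0w hM)); apply: seq_closed_of_closed.
have -> : e = enil M by apply: fun_var_ext => s x; case: (var_nil x).
by move=> Y hY; have [h1 h2] := h Y hY; split; [exact h1|exact h2].
Qed.
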